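(* Let $f:\{0,1\}^n\times\{0,1\}^n\to\{-1,1\}$ be a total Boolean function. Then $BQC(f)=\Omega(H(\sigma^2(f))/\log n)$. Moreover, for $k\ge1$ let $\kappa_k=\sigma_1(f)+\cdots+\sigma_k(f)$. Then (asymptotically): if $\kappa_k\ge\Omega(\sqrt{k})$, then $BQC(f)=\Omega(\log\kappa_k)$; if $\kappa_k\le O(\sqrt{k})$, then \[BQC(f)=\Omega\!\left(\frac{\log\kappa_k}{\log(\sqrt{k})-\log\kappa_k+1}\right).\]
   Context: $M_f$ is the $2^n\times2^n$ matrix with entry $f(x,y)/2^n$ in row $x$, column $y$. $\sigma_1(f)\ge\sigma_2(f)\ge\cdots\ge\sigma_{2^n}(f)$ are the singular values of $M_f$ (their squares sum to 1), $\sigma^2(f)$ is the vector of their squares, and $H(\sigma^2(f))=-\sum_i\sigma_i(f)^2\log\sigma_i(f)^2$ (base 2, $0\log0=0$). Quantum communication model (Yao, no prior entanglement): Alice receives $x$, Bob $y$; each holds private qubits initialized to the input and $|0\rangle$; in each round one player applies a unitary to his qubits and sends one qubit; at the end a qubit is measured giving the output; cost is the number of qubits exchanged. $BQC(f)$ is the minimum cost of a protocol computing $f$ with error probability at most $1/3$ on every input. *)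

(* Defs.v *)
From Stdlib Require Import Reals.
From HB Require Import structures.
From mathcomp Require Import all_boot all_order all_algebra.
From mathcomp Require Import complex.
From mathcomp Require Import boolp classical_sets reals Rstruct.
Import Order.TTheory GRing.Theory Num.Theory.


Local Open Scope ring_scope.

Definition Bits (n : nat) := {ffun 'I_n -> bool}.

Definition log2 (x : R) : R := ln x / ln 2.

Definition xlog2x (t : R) : R := if t == 0 then 0 else t * log2 t.

Definition entropy_sq (s : seq R) : R := - \sum_(a <- s) xlog2x (a ^+ 2).

Definition Mf {n : nat} (f : Bits n -> Bits n -> R) : 'M[R]_(#|{: Bits n}|) :=
  \matrix_(i, j) (f (enum_val i) (enum_val j) / 2 ^+ n).

Definition singular_values {m : nat} (M : 'M[R]_m) (s : seq R) : Prop :=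
  [/\ size s = m,
      (forall i : nat, (i < m)%N -> 0 <= s`_i),
      (forall i j : nat, (i <= j)%N -> (j < m)%N -> s`_j <= s`_i)
    & exists U V : 'M[R]_m,
      [/\ U *m U^T = 1%:M, V *m V^T = 1%:M
        & U^T *m M *m V = diag_mx (\row_(i < m) s`_i)]].

(* kappa_k = sigma_1 + ... + sigma_k  (sigma_i = 0 for i > 2^n) *)
Definition kappa (s : seq R) (k : nat) : R := \sum_(i < k) s`_i.

(* Yao's quantum communication model (no prior entanglement)           *)

Notation C := (R[i]).

(* A protocol works on N qubits; computational basis states are Bits N.
   Operators are given by their matrices Bits N -> Bits N -> C, states
   by their amplitude vectors Bits N -> C.
   Ownership: own : Bits N, own i = true iff qubit i is held by Alice. *)

Definition sqnorm (z : C) : R := let: Complex a b := z in a ^+ 2 + b ^+ 2.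

Definition unitary {N : nat} (U : Bits N -> Bits N -> C) : Prop :=
  forall b b' : Bits N,
    \sum_(c : Bits N) U b c * conjc (U b' c) = (b == b')%:R.

Definition apply_op {N : nat} (U : Bits N -> Bits N -> C) (psi : Bits N -> C)
  : Bits N -> C := fun b => \sum_(c : Bits N) U b c * psi c.

Definition mask {N : nat} (own : Bits N) (p : bool) (b : Bits N) : Bits N :=
  [ffun i => if own i == p then b i else false].

(* V acting on the qubits held by p, tensored with the identity on the
   other player's qubits (only the entries of V on p's qubits matter) *)
Definition local_op {N : nat} (own : Bits N) (p : bool)
  (V : Bits N -> Bits N -> C) : Bits N -> Bits N -> C :=
  fun b b' => if [forall i, (own i != p) ==> (b i == b' i)]
              then V (mask own p b) (mask own p b') else 0.

(* A round: player r_player applies a unitary to his qubits and then sends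
   the qubit r_sent (which he must hold) to the other player. *)
Record round (N : nat) := Round {
  r_player : bool;
  r_op : Bits N -> Bits N -> C;
  r_sent : 'I_N }.

Arguments r_player {N} r.
Arguments r_op {N} r _ _.
Arguments r_sent {N} r.

Definition own_after {N : nat} (own : Bits N) (r : round N) : Bits N :=
  [ffun i => if i == r_sent r then ~~ r_player r else own i].

Fixpoint valid_rounds {N : nat} (own : Bits N) (rs : seq (round N)) : Prop :=
  match rs with
  | [::] => True
  | r :: rs' => [/\ own (r_sent r) = r_player r,
                    unitary (local_op own (r_player r) (r_op r))
                  & valid_rounds (own_after own r) rs']
  end.

Fixpoint final_owner {N : nat} (own : Bits N) (rs : seq (round N)) : Bits N :=
  match rs with
  | [::] => own
  | r :: rs' => final_owner (own_after own r) rs'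
  end.

Fixpoint run {N : nat} (own : Bits N) (psi : Bits N -> C) (rs : seq (round N))
  : Bits N -> C :=
  match rs with
  | [::] => psi
  | r :: rs' => run (own_after own r)
                    (apply_op (local_op own (r_player r) (r_op r)) psi) rs'
  end.

(* A protocol on inputs x, y in {0,1}^n.  Alice's input x is written in the
   qubits inA j, Bob's input y in the qubits inB j; all other qubits start
   in |0>.  Initially Alice holds exactly the qubits with own0 = true.
   After the rounds, the player fin_player applies a final unitary to his
   qubits and measures his qubit out_q in the computational basis;
   outcome 0 means output 1, outcome 1 means output -1. *)
Record protocol (n : nat) := Protocol {
  p_N : nat;
  p_inA : 'I_n -> 'I_p_N;
  p_inB : 'I_n -> 'I_p_N;
  p_own0 : Bits p_N;
  p_rounds : seq (round p_N);
  p_fin_player : bool;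
  p_fin_op : Bits p_N -> Bits p_N -> C;
  p_out : 'I_p_N }.

Arguments p_N {n} p.
Arguments p_inA {n} p _.
Arguments p_inB {n} p _.
Arguments p_own0 {n} p.
Arguments p_rounds {n} p.
Arguments p_fin_player {n} p.
Arguments p_fin_op {n} p _ _.
Arguments p_out {n} p.

Definition cost {n : nat} (P : protocol n) : nat := size (p_rounds P).

Definition valid_protocol {n : nat} (P : protocol n) : Prop :=
  let own_f := final_owner (p_own0 P) (p_rounds P) in
  [/\ injective (p_inA P), injective (p_inB P),
      (forall j j', p_inA P j != p_inB P j'),
      (forall j, p_own0 P (p_inA P j) = true)
    & (forall j, p_own0 P (p_inB P j) = false)] /\
  [/\ valid_rounds (p_own0 P) (p_rounds P),
      unitary (local_op own_f (p_fin_player P) (p_fin_op P))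
    & own_f (p_out P) = p_fin_player P].

Definition init_basis {n : nat} (P : protocol n) (x y : Bits n) : Bits (p_N P) :=
  [ffun i => [exists j, (p_inA P j == i) && x j]
             || [exists j, (p_inB P j == i) && y j]].

Definition final_state {n : nat} (P : protocol n) (x y : Bits n)
  : Bits (p_N P) -> C :=
  let own_f := final_owner (p_own0 P) (p_rounds P) in
  apply_op (local_op own_f (p_fin_player P) (p_fin_op P))
    (run (p_own0 P) (fun b => (b == init_basis P x y)%:R) (p_rounds P)).

Definition prob_outcome {n : nat} (P : protocol n) (x y : Bits n) (m : bool) : R :=
  \sum_(b : Bits (p_N P) | b (p_out P) == m) sqnorm (final_state P x y b).

Definition error_prob {n : nat} (P : protocol n) (x y : Bits n) (v : R) : R :=
  if v == 1 then prob_outcome P x y true else prob_outcome P x y false.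

Definition computes {n : nat} (P : protocol n) (f : Bits n -> Bits n -> R) : Prop :=
  valid_protocol P /\ forall x y, error_prob P x y (f x y) <= 1 / 3.

Definition BQC {n : nat} (f : Bits n -> Bits n -> R) : R :=
  inf [set r : R | exists P : protocol n, computes P f /\ r = (cost P)%:R].

(* Main.v *)
(* By the Yao-Kremer decomposition, the acceptance probabilities of a protocol of
   cost [c] form a sum of [4 ^ c] products of functions of [x] alone and of [y]
   alone, all bounded by 1, so their projective norm is [2 ^ O(c)].  A majority
   polynomial of degree [O(log 1/eps)] turns them into a function [g] with
   [|f - g| <= eps] and projective norm [T = 2 ^ O(c log 1/eps)].
   Let [W] have the same singular vectors as [Mf f] and singular values [w_i].
   Testing [f = (f - g) + g] against [W] gives
     [sum_i sigma_i w_i <= eps |w|_2 + T |w|_oo].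
   For [w] the indicator of the first [k] indices this reads
   [kappa_k <= eps sqrt k + T], and [eps] of order [kappa_k / sqrt k] yields the
   bounds on [log kappa_k].  For the entropy take [eps = 1 / n] and
   [w_i = sigma_i] where [sigma_i < 1 / (n T)], [w_i = 0] elsewhere: the small
   singular values then carry weight [O(1 / n)], hence entropy [O(1)], and the large
   ones contribute at most [2 log (n T)].
   The additive constants are absorbed because a protocol of cost 0 forces [Mf f] to
   have rank 1, where both [log kappa_k <= 0] and [H = 0]. *)

Require Import Defs.
From Stdlib Require Import Reals.
From HB Require Import structures.
From mathcomp Require Import all_boot all_order all_algebra.
From mathcomp Require Import complex.
From mathcomp Require Import boolp classical_sets reals Rstruct.
From mathcomp Require Import ring lra zify.
Import Order.TTheory GRing.Theory Num.Theory.
Local Open Scope ring_scope.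

Set Implicit Arguments.
Unset Strict Implicit.
Unset Printing Implicit Defensive.

(* [seq.mask] shadows it. *)
Local Notation mask := Defs.mask.

(** * Projective norm *)

(* The projective tensor norm on [l_infty (X) l_infty], expressed by duality: this
   makes it multiplicative under entrywise products without handling decompositions. *)
Definition proj_norm_le (X Y : finType) (T : R) (g : X -> Y -> R) : Prop :=
  forall (W : X -> Y -> R) (K : R),
    (forall (a : X -> R) (b : Y -> R),
       (forall x, `|a x| <= 1) -> (forall y, `|b y| <= 1) ->
       \sum_x \sum_y a x * b y * W x y <= K) ->
    \sum_x \sum_y g x y * W x y <= T * K.

(* Keeps [T] from being read in [R_scope]. *)
Arguments proj_norm_le {X Y} T%_ring_scope g.

Section ProjNorm.
Variables X Y : finType.
Implicit Types (T : R) (g h : X -> Y -> R).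

Lemma eq_proj_norm_le T g h :
  (forall x y, g x y = h x y) -> proj_norm_le T g -> proj_norm_le T h.
Proof.
move=> gh hg W K hW; rewrite (eq_bigr (fun x => \sum_y g x y * W x y)) ?hg //.
by move=> x _; apply: eq_bigr => y _; rewrite gh.
Qed.

Lemma proj_norm_rank1 (a : X -> R) (b : Y -> R) :
  (forall x, `|a x| <= 1) -> (forall y, `|b y| <= 1) ->
  proj_norm_le 1 (fun x y => a x * b y).
Proof. by move=> ha hb W K hW; rewrite mul1r; apply: hW. Qed.

Lemma proj_norm_leD T1 T2 g1 g2 :
  proj_norm_le T1 g1 -> proj_norm_le T2 g2 ->
  proj_norm_le (T1 + T2) (fun x y => g1 x y + g2 x y).
Proof.
move=> h1 h2 W K hW; rewrite mulrDl.
apply: le_trans (lerD (h1 W K hW) (h2 W K hW)).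
rewrite -big_split /= le_eqVlt; apply/orP; left; apply/eqP.
apply: eq_bigr => x _; rewrite -big_split /=.
by apply: eq_bigr => y _; rewrite mulrDl.
Qed.

Lemma proj_norm_le_sum (I : finType) T (g : I -> X -> Y -> R) :
  (forall i, proj_norm_le T (g i)) ->
  proj_norm_le (#|I|%:R * T) (fun x y => \sum_i g i x y).
Proof.
move=> hg W K hW.
have -> : \sum_x \sum_y (\sum_i g i x y) * W x y =
  \sum_i \sum_x \sum_y g i x y * W x y.
  rewrite [RHS]exchange_big /=; apply: eq_bigr => x _.
  rewrite [RHS]exchange_big /=; apply: eq_bigr => y _.
  by rewrite mulr_suml.
have -> : #|I|%:R * T * K = \sum_(i : I) T * K.
  by rewrite sumr_const -mulrA mulr_natl.
by apply: ler_sum => i _; apply: hg.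
Qed.

Lemma proj_norm_leN T g :
  proj_norm_le T g -> proj_norm_le T (fun x y => - g x y).
Proof.
move=> hg W K hW.
rewrite (eq_bigr (fun x => \sum_y g x y * - W x y)); last first.
  by move=> x _; apply: eq_bigr => y _; rewrite mulrN mulNr.
apply: hg => a b ha hb.
rewrite (eq_bigr (fun x => \sum_y (- a x) * b y * W x y)).
  by apply: (hW (fun x => - a x)) => // x; rewrite normrN.
by move=> x _; apply: eq_bigr => y _; rewrite mulrN !mulNr.
Qed.

Lemma proj_norm_leMn T g k :
  proj_norm_le T g -> proj_norm_le (T *+ k) (fun x y => g x y *+ k).
Proof.
move=> hg W K hW; rewrite mulrnAl.
rewrite (eq_bigr (fun x => (\sum_y g x y * W x y) *+ k)); last first.
  by move=> x _; rewrite -sumrMnl; apply: eq_bigr => y _; rewrite mulrnAl.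
by rewrite sumrMnl; apply: ler_wMn2r; apply: hg.
Qed.

(** Testing [g1] against the weight [g2 W] leaves, for each bounded pair [a], [b], a test of [g2]
    against [a b W]; products of bounded functions are again bounded, so the constants multiply. *)
Lemma proj_norm_leM T1 T2 g1 g2 :
  proj_norm_le T1 g1 -> proj_norm_le T2 g2 ->
  proj_norm_le (T1 * T2) (fun x y => g1 x y * g2 x y).
Proof.
move=> h1 h2 W K hW; rewrite -mulrA.
rewrite (eq_bigr (fun x => \sum_y g1 x y * (g2 x y * W x y))); last first.
  by move=> x _; apply: eq_bigr => y _; rewrite mulrA.
apply: h1 => a b ha hb.
rewrite (eq_bigr (fun x => \sum_y g2 x y * (a x * b y * W x y))); last first.
  by move=> x _; apply: eq_bigr => y _; rewrite mulrCA.
apply: h2 => a' b' ha' hb'.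
rewrite (eq_bigr (fun x => \sum_y (a' x * a x) * (b' y * b y) * W x y)).
  apply: (hW (fun x => a' x * a x) (fun y => b' y * b y)) => z;
    by rewrite normrM mulr_ile1.
by move=> x _; apply: eq_bigr => y _; ring.
Qed.

Lemma proj_norm_leX T g k :
  proj_norm_le T g -> proj_norm_le (T ^+ k) (fun x y => g x y ^+ k).
Proof.
move=> hg; elim: k => [|k IH].
  apply: (@eq_proj_norm_le _ (fun x y => 1 * 1)) => [x y|].
    by rewrite expr0 mulr1.
  by rewrite expr0; apply: proj_norm_rank1 => _; rewrite normr1.
rewrite exprS; apply: eq_proj_norm_le (proj_norm_leM hg IH) => x y.
by rewrite exprS.
Qed.

End ProjNorm.

(** * Amplification by majority vote *)

(* The bias of a majority vote over [2m+1] independent runs, where [p] and [q]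
   are the probabilities of the two outcomes of one run. *)
Definition majority_bias (m : nat) (p q : R) : R :=
  (\sum_(i < (2 * m).+2)
    (-1) ^+ (m < i)%N * (p ^+ ((2 * m).+1 - i) * q ^+ i *+ 'C((2 * m).+1, i)))%R.

(** The signs do not affect the projective norm, so the terms add up to the binomial expansion of
    [(T + T) ^ (2m+1)]. *)
Lemma proj_norm_majority (X Y : finType) (T : R) (p q : X -> Y -> R) (m : nat) :
  proj_norm_le T p -> proj_norm_le T q ->
  proj_norm_le ((2 * T) ^+ (2 * m).+1) (fun x y => majority_bias m (p x y) (q x y)).
Proof.
move=> hp hq.
have hterm (i : 'I_(2 * m).+2) : proj_norm_le (T ^+ (2 * m).+1 *+ 'C((2 * m).+1, i))
    (fun x y => (-1) ^+ (m < i)%N *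
       (p x y ^+ ((2 * m).+1 - i) * q x y ^+ i *+ 'C((2 * m).+1, i))).
  have h : proj_norm_le (T ^+ (2 * m).+1 *+ 'C((2 * m).+1, i))
    (fun x y => p x y ^+ ((2 * m).+1 - i) * q x y ^+ i *+ 'C((2 * m).+1, i)).
    apply: proj_norm_leMn.
    have -> : T ^+ (2 * m).+1 = T ^+ ((2 * m).+1 - i) * T ^+ i.
      by rewrite -exprD subnK // -ltnS.
    by apply: proj_norm_leM; apply: proj_norm_leX.
  case: (m < i)%N.
    by apply: eq_proj_norm_le (proj_norm_leN h) => x y; rewrite expr1 mulN1r.
  by apply: eq_proj_norm_le h => x y; rewrite expr0 mul1r.
have -> : (2 * T) ^+ (2 * m).+1 = \sum_(i < (2 * m).+2) T ^+ (2 * m).+1 *+ 'C((2 * m).+1, i).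
  rewrite mulr_natl mulr2n exprDn; apply: eq_bigr => i _.
  by rewrite -exprD subnK // -ltnS.
move=> W K hW; rewrite mulr_suml.
have -> : \sum_x \sum_y majority_bias m (p x y) (q x y) * W x y =
  \sum_(i < (2 * m).+2) \sum_x \sum_y (-1) ^+ (m < i)%N *
       (p x y ^+ ((2 * m).+1 - i) * q x y ^+ i *+ 'C((2 * m).+1, i)) * W x y.
  rewrite [RHS]exchange_big /=; apply: eq_bigr => x _.
  rewrite [RHS]exchange_big /=; apply: eq_bigr => y _.
  by rewrite mulr_suml.
by apply: ler_sum => i _; apply: hterm.
Qed.

(** The wrong votes form a majority. Each right vote pairs with a wrong one into
    [(1 - q) q <= 2 / 9]; the surplus wrong votes form [e] pairs with [q ^ 2 <= 1 / 9], and the odd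
    one out is at most 1. *)
Lemma vote_term_le (m i : nat) (q : R) :
  0 <= q <= 1 / 3 -> (m < i <= (2 * m).+1)%N ->
  (1 - q) ^+ ((2 * m).+1 - i) * q ^+ i <= (2 / 9) ^+ m.
Proof.
move=> hq him.
set e := (i - m.+1)%N.
have -> : ((2 * m).+1 - i = m - e)%N by rewrite /e; lia.
have -> : i = (m - e + (2 * e + 1))%N by rewrite /e; lia.
rewrite exprD mulrA -exprMn exprD exprM expr1.
have -> : (2 / 9) ^+ m = (2 / 9) ^+ (m - e) * (2 / 9) ^+ e :> R.
  by rewrite -exprD; congr (_ ^+ _); rewrite /e; lia.
apply: ler_pM.
- by apply: exprn_ge0; nra.
- by apply: mulr_ge0; [apply: exprn_ge0; nra | lra].
- by apply: lerXn2r; rewrite ?nnegrE; nra.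
apply: le_trans (_ : (q ^+ 2) ^+ e <= _).
  by rewrite ler_piMr ?exprn_ge0 ?sqr_ge0; lra.
by apply: lerXn2r; rewrite ?nnegrE; nra.
Qed.

(** All binomial coefficients together give [2 ^ (2m+1) = 2 * 4 ^ m], and [4 * (2 / 9) = 8 / 9]. *)
Lemma vote_tail_le (m : nat) (P : pred nat) (F : nat -> R) :
  (forall i, (i <= (2 * m).+1)%N -> P i -> F i <= (2 / 9) ^+ m) ->
  \sum_(i < (2 * m).+2 | P i) F i *+ 'C((2 * m).+1, i) <= 2 * (8 / 9) ^+ m.
Proof.
move=> hF.
apply: le_trans (_ : \sum_(i < (2 * m).+2) (2 / 9) ^+ m *+ 'C((2 * m).+1, i) <= _).
  rewrite big_mkcond; apply: ler_sum => i _; case: ifP => // Pi.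
    by apply: ler_wMn2r; apply: hF => //; rewrite -ltnS.
  by apply: mulrn_wge0; apply: exprn_ge0; lra.
have -> : \sum_(i < (2 * m).+2) (2 / 9) ^+ m *+ 'C((2 * m).+1, i)
   = (2 / 9) ^+ m * (1 + 1) ^+ (2 * m).+1 :> R.
  rewrite exprDn mulr_sumr; apply: eq_bigr => i _.
  by rewrite !expr1n mulr1 mulrnAr mulr1.
have -> : 8 / 9 = (2 / 9) * (1 + 1) ^+ 2 :> R by field.
by rewrite [X in _ <= _ * X]exprMn exprS exprM; lra.
Qed.

(** The bias is [S0 - S1] with [S0 + S1 = 1], so its distance to [v] is twice the probability that
    the vote goes wrong. *)
Lemma majority_bias_error (m : nat) (p q v : R) :
  p + q = 1 -> 0 <= p -> 0 <= q -> v = 1 \/ v = -1 ->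
  (if v == 1 then q else p) <= 1 / 3 ->
  `|v - majority_bias m p q| <= 4 * (8 / 9) ^+ m.
Proof.
move=> pq p0 q0 hv.
pose F i := p ^+ ((2 * m).+1 - i) * q ^+ i.
have F0 i : 0 <= F i by rewrite mulr_ge0 ?exprn_ge0.
pose S1 := \sum_(i < (2 * m).+2 | (m < i)%N) F i *+ 'C((2 * m).+1, i).
pose S0 := \sum_(i < (2 * m).+2 | ~~ (m < i)%N) F i *+ 'C((2 * m).+1, i).
have S10 : 0 <= S1 by apply: sumr_ge0 => i _; apply: mulrn_wge0.
have S00 : 0 <= S0 by apply: sumr_ge0 => i _; apply: mulrn_wge0.
have S01 : S1 + S0 = 1.
  have := exprDn p q (2 * m).+1; rewrite pq expr1n => ->.
  by rewrite [RHS](bigID (fun i : 'I__ => (m < i)%N)).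
have -> : majority_bias m p q = S0 - S1.
  rewrite /majority_bias (bigID (fun i : 'I__ => (m < i)%N)) /= addrC; congr (_ + _).
    by apply: eq_bigr => i /negbTE ->; rewrite expr0 mul1r.
  by rewrite -sumrN; apply: eq_bigr => i ->; rewrite expr1 mulN1r.
case: hv => ->.
  rewrite eqxx => q3.
  have : S1 <= 2 * (8 / 9) ^+ m.
    apply: (@vote_tail_le m (fun i => (m < i)%N) F) => i im mi.
    have -> : F i = (1 - q) ^+ ((2 * m).+1 - i) * q ^+ i by rewrite -pq addrK.
    by apply: vote_term_le; [lra | rewrite mi].
  by move=> h; rewrite ler_norml; lra.
have -> : (-1 == 1 :> R) = false by apply/eqP; lra.
move=> p3.
have : S0 <= 2 * (8 / 9) ^+ m.
  apply: (@vote_tail_le m (fun i => ~~ (m < i)%N) F) => i im mi.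
  have -> : F i = (1 - p) ^+ ((2 * m).+1 - ((2 * m).+1 - i)) * p ^+ ((2 * m).+1 - i).
    by rewrite /F -pq [p + q]addrC addrK subKn // mulrC.
  by apply: vote_term_le; [lra | lia].
by move=> h; rewrite ler_norml; lra.
Qed.

(** * Singular values *)

Section SingularTest.
Variables (M : nat) (U V : 'M[R]_M).
Hypotheses (UU : U *m U^T = 1%:M) (VV : V *m V^T = 1%:M).

Definition with_spectrum (d : 'rV[R]_M) : 'M[R]_M := U *m diag_mx d *m V^T.

(** The left side is a trace, and its cyclicity lets the orthogonal factors cancel. *)
Lemma with_spectrum_dot (d e : 'rV[R]_M) :
  \sum_i \sum_j with_spectrum d i j * with_spectrum e i j =
  \sum_l d 0 l * e 0 l.
Proof.
have -> : \sum_i \sum_j with_spectrum d i j * with_spectrum e i j =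
    \tr ((with_spectrum d)^T *m with_spectrum e).
  rewrite exchange_big /= /mxtrace; apply: eq_bigr => j _.
  by rewrite mxE; apply: eq_bigr => i _; rewrite [_^T _ _]mxE.
rewrite /with_spectrum !trmx_mul trmxK tr_diag_mx.
rewrite !mulmxA mxtrace_mulC !mulmxA (mulmx1C VV) mul1mx.
rewrite -(mulmxA (diag_mx d)) (mulmx1C UU) mulmx1 mulmx_diag mxtrace_diag.
by apply: eq_bigr => l _; rewrite mxE.
Qed.

Lemma orthogonal_norm (Q : 'M[R]_M) (a : 'rV[R]_M) :
  Q *m Q^T = 1%:M -> \sum_l (a *m Q) 0 l ^+ 2 = \sum_i a 0 i ^+ 2.
Proof.
move=> QQ.
have norm_mx (b : 'rV[R]_M) : \sum_i b 0 i ^+ 2 = (b *m b^T) 0 0.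
  by rewrite mxE; apply: eq_bigr => i _; rewrite [_^T _ _]mxE expr2.
by rewrite !norm_mx trmx_mul mulmxA -(mulmxA a) QQ mulmx1.
Qed.

(** The operator norm is at most [delta], and [a], [b] have squared length at most [M]. In the
    singular bases the form is diagonal, so AM-GM term by term suffices. *)
Lemma with_spectrum_form_le (w : 'rV[R]_M) (delta : R) (a b : 'I_M -> R) :
  0 <= delta -> (forall l, 0 <= w 0 l <= delta) ->
  (forall i, `|a i| <= 1) -> (forall j, `|b j| <= 1) ->
  \sum_i \sum_j a i * b j * with_spectrum w i j <= delta * M%:R.
Proof.
move=> delta0 hw ha hb.
pose ar : 'rV[R]_M := \row_i a i; pose br : 'rV[R]_M := \row_i b i.
have -> : \sum_i \sum_j a i * b j * with_spectrum w i j =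
    \sum_l w 0 l * ((ar *m U) 0 l * (br *m V) 0 l).
  transitivity ((ar *m with_spectrum w *m br^T) 0 0).
    rewrite exchange_big /= mxE; apply: eq_bigr => j _.
    rewrite [br^T j 0]mxE [br 0 j]mxE [(ar *m _) 0 j]mxE mulr_suml; apply: eq_bigr => i _.
    by rewrite [ar 0 i]mxE mulrAC.
  rewrite /with_spectrum !mulmxA -(mulmxA _ V^T) -trmx_mul mxE.
  apply: eq_bigr => l _; rewrite mul_mx_diag !mxE.
  by rewrite mulrAC mulrA [X in X = _]mulrC mulrA.
have norm_le (c : 'I_M -> R) : (forall i, `|c i| <= 1) -> \sum_i (\row_i c i) 0 i ^+ 2 <= M%:R.
  move=> hc; rewrite -[X in _ <= X%:R]card_ord -sumr_const.
  apply: ler_sum => i _; rewrite mxE -real_normK ?num_real //.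
  by rewrite expr_le1.
apply: le_trans (_ : \sum_l delta / 2 * ((ar *m U) 0 l ^+ 2 + (br *m V) 0 l ^+ 2) <= _).
  apply: ler_sum => l _; have := hw l.
  move: (w 0 l) ((ar *m U) 0 l) ((br *m V) 0 l) => t u v ht.
  apply: le_trans (_ : t / 2 * (u ^+ 2 + v ^+ 2) <= _); last first.
    by apply: ler_wpM2r; [rewrite addr_ge0 ?sqr_ge0 | lra].
  rewrite -subr_ge0.
  have -> : t / 2 * (u ^+ 2 + v ^+ 2) - t * (u * v) = t / 2 * (u - v) ^+ 2 by field.
  by rewrite mulr_ge0 ?sqr_ge0 //; lra.
rewrite -mulr_sumr big_split /= !orthogonal_norm //.
have := norm_le a ha; have := norm_le b hb; rewrite -/ar -/br => h1 h2.
by nra.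
Qed.

End SingularTest.

Lemma Mf_spectral (n : nat) (f : Bits n -> Bits n -> R) (s : seq R) :
  singular_values (Mf f) s ->
  exists U V : 'M[R]_(#|{: Bits n}|),
    [/\ U *m U^T = 1%:M, V *m V^T = 1%:M
      & Mf f = with_spectrum U V (\row_i s`_i)].
Proof.
case=> _ _ _ [U [V [UU VV UMV]]]; exists U, V; split=> //.
by rewrite /with_spectrum -UMV !mulmxA UU mul1mx -mulmxA VV mulmx1.
Qed.

Lemma card_Bits (n : nat) : #|{: Bits n}| = (2 ^ n)%N.
Proof. by rewrite card_ffun card_bool card_ord. Qed.

(** Both sides are the squared Frobenius norm of [Mf f], whose [4 ^ n] entries are all [2 ^ -n] up
    to sign. *)
Lemma singular_values_sqr_sum (n : nat) (f : Bits n -> Bits n -> R) (s : seq R) :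
  (forall x y, f x y = 1 \/ f x y = -1) -> singular_values (Mf f) s ->
  \sum_(l < #|{: Bits n}|) s`_l ^+ 2 = 1.
Proof.
move=> hf /Mf_spectral[U [V [UU VV def_M]]].
have := with_spectrum_dot UU VV (\row_i s`_i) (\row_i s`_i); rewrite -def_M.
under [X in _ = X -> _]eq_bigr do rewrite !mxE -expr2.
move=> <-.
rewrite (eq_bigr (fun i => \sum_(j < #|{: Bits n}|) (2 ^+ n)^-2)).
  rewrite !sumr_const card_ord card_Bits -mulrnA -[LHS]mulr_natr natrM natrX.
  by rewrite expr2 mulVf // mulf_neq0 // expf_neq0 // pnatr_eq0.
move=> i _; apply: eq_bigr => j _; rewrite !mxE.
by case: (hf (enum_val i) (enum_val j)) => ->; field; rewrite expf_neq0 // pnatr_eq0.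
Qed.

(* Pairing [Mf f] with the matrix that has the singular vectors of [Mf f] and the
   spectrum [w]: the approximation error is controlled by its Frobenius norm, and
   the approximant by its operator norm. *)
Lemma spectral_test (n : nat) (f g : Bits n -> Bits n -> R) (s : seq R)
    (T eps delta lam : R) (w : 'I_(#|{: Bits n}|) -> R) :
  singular_values (Mf f) s ->
  (forall x y, `|f x y - g x y| <= eps) ->
  proj_norm_le T (fun i j : 'I_(#|{: Bits n}|) => g (enum_val i) (enum_val j)) ->
  0 <= delta -> (forall l, 0 <= w l <= delta) -> 0 < lam ->
  \sum_(l < #|{: Bits n}|) s`_l * w l <= (lam * eps ^+ 2 + (\sum_l w l ^+ 2) / lam) / 2 + T * delta.
Proof.
move=> /Mf_spectral[U [V [UU VV def_M]]] hfg hg delta0 hw lam0.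
pose wr : 'rV[R]_(#|{: Bits n}|) := \row_l w l.
pose W := with_spectrum U V wr.
have dN : (#|{: Bits n}|)%:R = 2 ^+ n :> R by rewrite card_Bits natrX.
have N0 : 0 < 2 ^+ n :> R by rewrite exprn_gt0 //; lra.
have hWs : \sum_(l < #|{: Bits n}|) s`_l * w l = \sum_i \sum_j Mf f i j * W i j.
  rewrite def_M with_spectrum_dot //.
  by apply: eq_bigr => l _; rewrite !mxE.
have hWW : \sum_l w l ^+ 2 = \sum_i \sum_j W i j ^+ 2.
  transitivity (\sum_i \sum_j W i j * W i j); last first.
    by apply: eq_bigr => i _; apply: eq_bigr => j _; rewrite expr2.
  by rewrite with_spectrum_dot //; apply: eq_bigr => l _; rewrite !mxE expr2.
have hgW : \sum_i \sum_j g (enum_val i) (enum_val j) * W i j <= T * (delta * 2 ^+ n).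
  apply: hg => a b ha hb; rewrite -dN.
  by apply: with_spectrum_form_le => // l; rewrite mxE.
pose E (i j : 'I_(#|{: Bits n}|)) := (f (enum_val i) (enum_val j) - g (enum_val i) (enum_val j)) / 2 ^+ n.
have -> : \sum_(l < #|{: Bits n}|) s`_l * w l = \sum_i \sum_j E i j * W i j +
   (\sum_i \sum_j g (enum_val i) (enum_val j) * W i j) / 2 ^+ n.
  rewrite hWs mulr_suml -big_split /=; apply: eq_bigr => i _.
  rewrite mulr_suml -big_split /=; apply: eq_bigr => j _.
  by rewrite /E [Mf f i j]mxE; field; rewrite gt_eqF.
apply: lerD; last first.
  by rewrite ler_pdivrMr // -mulrA.
have -> : lam * eps ^+ 2 =
    \sum_(i < #|{: Bits n}|) \sum_(j < #|{: Bits n}|) lam * (eps / 2 ^+ n) ^+ 2.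
  rewrite !sumr_const card_ord -mulrnA -[RHS]mulr_natr natrM dN.
  by field; rewrite gt_eqF.
rewrite hWW mulr_suml -big_split /= mulr_suml; apply: ler_sum => i _.
rewrite mulr_suml -big_split /= mulr_suml; apply: ler_sum => j _.
have hE : E i j ^+ 2 <= (eps / 2 ^+ n) ^+ 2.
  rewrite -(real_normK (num_real (E i j))); apply: lerXn2r; rewrite ?nnegrE //.
    apply: divr_ge0; last exact: ltW.
    exact: le_trans (hfg (enum_val i) (enum_val j)).
  by rewrite normrM normfV (ger0_norm (ltW N0)) ler_pM2r ?invr_gt0.
(* AM-GM with weight [lam] stands in for Cauchy-Schwarz and avoids square roots of sums; each
   application chooses its own [lam]. *)
apply: le_trans (_ : (lam * E i j ^+ 2 + W i j ^+ 2 / lam) / 2 <= _).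
  rewrite -subr_ge0.
  have -> : (lam * E i j ^+ 2 + W i j ^+ 2 / lam) / 2 - E i j * W i j =
     lam / 2 * (E i j - W i j / lam) ^+ 2 by field; rewrite gt_eqF.
  by rewrite mulr_ge0 ?sqr_ge0 //; lra.
by rewrite ler_pM2r ?invr_gt0; [apply: lerD => //; rewrite ler_pM2l | lra].
Qed.

(** * Decomposition of the final state *)

Lemma maskK (N : nat) (own : Bits N) p b : mask own p (mask own p b) = mask own p b.
Proof. by apply/ffunP => i; rewrite !ffunE; case: eqP. Qed.

Lemma mask_inj (N : nat) (own : Bits N) p b b' :
  mask own p b = mask own p b' -> mask own (~~ p) b = mask own (~~ p) b' -> b = b'.
Proof.
move=> /ffunP h /ffunP h'; apply/ffunP => i.
by move: (h i) (h' i); rewrite !ffunE; case: (own i); case: p {h h'}.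
Qed.

(* The Hilbert space of all qubits is the tensor product of the players' spaces. *)
Lemma sum_mask (A : comPzRingType) (N : nat) (own : Bits N) p (F G : Bits N -> A) :
  \sum_b F (mask own p b) * G (mask own (~~ p) b) =
  (\sum_(a | mask own p a == a) F a) * (\sum_(b | mask own (~~ p) b == b) G b).
Proof.
pose join (ab : Bits N * Bits N) : Bits N :=
  [ffun i => if own i == p then ab.1 i else ab.2 i].
have mask_join1 a b : mask own p a = a -> mask own p (join (a, b)) = a.
  by move=> ha; rewrite -[RHS]ha; apply/ffunP => i; rewrite !ffunE /=; case: eqP.
have mask_join2 a b : mask own (~~ p) b = b -> mask own (~~ p) (join (a, b)) = b.
  move=> hb; rewrite -[RHS]hb; apply/ffunP => i; rewrite !ffunE /=.
  by case: (own i); case: (p).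
rewrite big_distrlr /= pair_big /=.
rewrite (reindex_onto join (fun b => (mask own p b, mask own (~~ p) b))) /=; last first.
  by move=> b _; apply: (@mask_inj _ own p); rewrite ?mask_join1 ?mask_join2 ?maskK.
apply: eq_big => [[a b]|[a b]] /=.
  apply/eqP/andP => [[<- <-]|[/eqP ha /eqP hb]]; first by rewrite !maskK.
  by rewrite mask_join1 ?mask_join2.
by move=> /eqP[-> ->].
Qed.

(** * Squared norms and local unitaries *)

Lemma sqnormE z : sqnorm z = complex.Re (z * conjc z).
Proof. by case: z => a b /=; rewrite RplusE mulrN opprK -!expr2. Qed.

Lemma sqnorm_ge0 z : 0 <= sqnorm z.
Proof. by case: z => a b /=; rewrite RplusE addr_ge0 ?sqr_ge0. Qed.

Lemma sqnormC z : (sqnorm z)%:C%C = z * conjc z.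
Proof. by case: z => a b; rewrite /sqnorm /= RplusE; simpc; congr Complex; ring. Qed.

Lemma sqnormM z t : sqnorm (z * t) = sqnorm z * sqnorm t.
Proof. by case: z => a b; case: t => c d; rewrite /sqnorm /= !RplusE; ring. Qed.

Lemma sqnorm_bool (e : bool) : sqnorm e%:R = e%:R.
Proof. by case: e; rewrite /sqnorm /= RplusE; ring. Qed.

(** [unitary] states that the rows are orthonormal, while preserving norms uses the columns; for
    square matrices [mulmx1C] turns one into the other. *)
Lemma unitary_norm (N : nat) (U : Bits N -> Bits N -> R[i]) (phi : Bits N -> R[i]) :
  unitary U -> \sum_b sqnorm (apply_op U phi b) = \sum_b sqnorm (phi b).
Proof.
move=> hU.
have hU' c c' : \sum_b conjc (U b c) * U b c' = (c == c')%:R.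
  pose A : 'M[R[i]]_(#|{: Bits N}|) := \matrix_(i, j) U (enum_val i) (enum_val j).
  pose B : 'M[R[i]]_(#|{: Bits N}|) := \matrix_(i, j) conjc (U (enum_val j) (enum_val i)).
  have AB : A *m B = 1%:M.
    apply/matrixP => i j; rewrite !mxE -(inj_eq enum_val_inj) -hU.
    by rewrite [RHS](reindex _ (onW_bij _ (@enum_val_bij _))) /=; apply: eq_bigr => k _; rewrite !mxE.
  have /matrixP/(_ (enum_rank c) (enum_rank c')) := mulmx1C AB.
  rewrite !mxE (inj_eq enum_rank_inj) => <-.
  rewrite [LHS](reindex _ (onW_bij _ (@enum_val_bij _))) /=.
  by apply: eq_bigr => k _; rewrite !mxE !enum_rankK.
apply: complexI; rewrite !rmorph_sum /=.
under eq_bigr do rewrite sqnormC /apply_op rmorph_sum /= big_distrlr /=.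
rewrite exchange_big /=; apply: eq_bigr => c _.
rewrite exchange_big /= (bigD1 c) //= [X in _ + X]big1 ?addr0 => [|c' c'c].
  transitivity ((\sum_b conjc (U b c) * U b c) * (phi c * conjc (phi c))); last first.
    by rewrite hU' eqxx mul1r sqnormC.
  rewrite mulr_suml; apply: eq_bigr => b _; rewrite rmorphM /=; ring.
rewrite (eq_bigr (fun b => (conjc (U b c') * U b c) * (phi c * conjc (phi c')))).
  by rewrite -mulr_suml hU' (negbTE c'c) mul0r.
by move=> b _; rewrite rmorphM /=; ring.
Qed.

(** The basis states of a player's own space are encoded as the strings that vanish on the other
    player's qubits. *)
Definition player_sqnorm (N : nat) (own : Bits N) p (phi : Bits N -> R[i]) : R :=
  (\sum_(b | mask own p b == b) sqnorm (phi b))%R.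

Definition local_apply (N : nat) (own : Bits N) p (V : Bits N -> Bits N -> R[i])
    (phi : Bits N -> R[i]) : Bits N -> R[i] :=
  fun b => \sum_(a | mask own p a == a) V b a * phi a.

(** An entry of [local_op] is an entry of [V] times a delta on the other player's bits, so the sum
    over [c] factorises by [sum_mask]. *)
Lemma apply_local_op (N : nat) (own : Bits N) p (V : Bits N -> Bits N -> R[i])
    (phi chi : Bits N -> R[i]) b :
  apply_op (local_op own p V)
    (fun c => phi (mask own p c) * chi (mask own (~~ p) c)) b =
  local_apply own p V phi (mask own p b) * chi (mask own (~~ p) b).
Proof.
rewrite /apply_op /local_op.
have agree (c : Bits N) : [forall i, (own i != p) ==> (b i == c i)] =
    (mask own (~~ p) c == mask own (~~ p) b).
  apply/forallP/eqP => [h|/ffunP h i].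
    apply/ffunP => i; rewrite !ffunE; move: (h i).
    by case: (own i); case: p {h} => //= /eqP.
  by apply/implyP; move: (h i); rewrite !ffunE; case: (own i); case: p {h} => //= ->.
rewrite (eq_bigr (fun c => (V (mask own p b) (mask own p c) * phi (mask own p c)) *
   ((mask own (~~ p) c == mask own (~~ p) b)%:R * chi (mask own (~~ p) c)))); last first.
  move=> c _; rewrite agree; case: eqP => _; last by rewrite !mul0r mulr0.
  by rewrite mul1r mulrA.
rewrite (@sum_mask _ _ own p (fun a => V (mask own p b) a * phi a)
   (fun d => (d == mask own (~~ p) b)%:R * chi d)); congr (_ * _).
rewrite (bigD1 (mask own (~~ p) b)) ?maskK //= eqxx mul1r big1 ?addr0 //.
by move=> d /andP[_ /negbTE ->]; rewrite mul0r.
Qed.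

(** Unitarity is known on the whole space only; tensoring with the all-zero state [chi] of the other
    player carries norm preservation over to one factor. *)
Lemma player_sqnorm_local (N : nat) (own : Bits N) p (V : Bits N -> Bits N -> R[i])
    (phi : Bits N -> R[i]) :
  unitary (local_op own p V) ->
  player_sqnorm own p (local_apply own p V phi) = player_sqnorm own p phi.
Proof.
move=> hU.
pose z : Bits N := [ffun=> false].
have hz : mask own (~~ p) z = z by apply/ffunP => i; rewrite !ffunE; case: ifP.
pose chi (d : Bits N) : R[i] := (d == z)%:R.
have norm_prod (theta : Bits N -> R[i]) :
    \sum_b sqnorm (theta (mask own p b) * chi (mask own (~~ p) b)) = player_sqnorm own p theta.
  under eq_bigr do rewrite sqnormM.
  rewrite (@sum_mask _ _ own p (fun b => sqnorm (theta b)) (fun b => sqnorm (chi b))).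
  rewrite [X in _ * X](bigD1 z) ?hz //= [X in _ * (_ + X)]big1.
    by rewrite addr0 sqnorm_bool eqxx mulr1.
  by move=> d /andP[_ /negbTE dz]; rewrite sqnorm_bool dz.
rewrite -!norm_prod -[RHS](unitary_norm _ hU); apply: eq_bigr => b _.
by rewrite apply_local_op.
Qed.

(** * The Yao-Kremer decomposition, round by round *)

Section SplitStates.
Variables (n N : nat).
Implicit Types (own : Bits N) (psi : Bits n -> Bits n -> Bits N -> R[i]).

(* The Yao-Kremer decomposition: every qubit sent doubles the index set [I]. *)
Definition split_state own (I : finType) psi : Prop :=
  exists gamma : bool -> I -> Bits n -> Bits N -> R[i],
    (forall p i z, player_sqnorm own p (gamma p i z) <= 1) /\
    forall x y b, psi x y b =
      \sum_i gamma true i x (mask own true b) * gamma false i y (mask own false b).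

(** Puts the factor of the acting player first, so that one argument serves both players. *)
Lemma split_stateP own I psi p :
  split_state own I psi <->
  exists gamma : bool -> I -> Bits n -> Bits N -> R[i],
    (forall q i z, player_sqnorm own q (gamma q i z) <= 1) /\
    forall x y b, psi x y b =
      \sum_i gamma p i (if p then x else y) (mask own p b) *
             gamma (~~ p) i (if ~~ p then x else y) (mask own (~~ p) b).
Proof.
split=> -[gamma [hn he]]; exists gamma; split=> // x y b; rewrite he;
  by case: p {he} => //=; apply: eq_bigr => i _; rewrite mulrC.
Qed.

Lemma split_state_local own I psi p (V : Bits N -> Bits N -> R[i]) :
  unitary (local_op own p V) -> split_state own I psi ->
  split_state own I (fun x y => apply_op (local_op own p V) (psi x y)).
Proof.
move=> hU /(split_stateP _ _ _ p)[gamma [hn he]]; apply/(split_stateP _ _ _ p).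
exists (fun q i z => if q == p then local_apply own p V (gamma q i z) else gamma q i z).
split=> [q i z|x y b].
  by case: eqP => [->|_]; rewrite ?player_sqnorm_local.
rewrite /apply_op.
under eq_bigr do rewrite he mulr_sumr.
rewrite exchange_big /=; apply: eq_bigr => i _.
have -> : (~~ p == p) = false by case: (p).
rewrite eqxx -(apply_local_op own p V _ (gamma (~~ p) i (if ~~ p then x else y))).
by [].
Qed.

Definition set_bit (s : 'I_N) (v : bool) (b : Bits N) : Bits N :=
  [ffun i => if i == s then v else b i].

(** The sender's vector is expanded along the value [v] of the qubit that leaves; the receiver's
    vector gains that qubit in the basis state [v]. *)
Lemma split_state_send own I psi (r : round N) :
  own (r_sent r) = r_player r -> split_state own I psi ->
  split_state (own_after own r) (I * bool)%type psi.
Proof.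
set p := r_player r; set s := r_sent r => hs.
move=> /(split_stateP _ _ _ p)[gamma [hn he]]; apply/(split_stateP _ _ _ p).
set own' := own_after own r.
have own'E i : own' i = if i == s then ~~ p else own i by rewrite ffunE.
clearbody own'.
(* Strings of the receiver's former space have 0 at [s], strings of the sender's new space too,
   hence the two uses of [set_bit]. *)
exists (fun q iv z b => if q == p then gamma q iv.1 z (set_bit s iv.2 b)
   else (b s == iv.2)%:R * gamma q iv.1 z (set_bit s false b)).
have NpF : (~~ p == p) = false by case: (p).
split=> [q [i v] z /=|x y b].
  apply: le_trans (hn q i z); rewrite /player_sqnorm.
  have [->|qp] := eqVneq q p.
    (* Sender: fixing the sent bit keeps one of two slices of the old vector, so the norm cannot
       grow. *)
    rewrite [X in _ <= X](bigID (fun b : Bits N => b s == v)) /=.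
    apply: le_trans (_ : \sum_(b | (mask own p b == b) && (b s == v)) sqnorm (gamma p i z b) <= _);
      last by rewrite lerDl; apply: sumr_ge0 => b _; exact: sqnorm_ge0.
    rewrite [X in _ <= X](reindex_onto (set_bit s v) (set_bit s false)); last first.
      move=> b /andP[_ /eqP bs]; apply/ffunP => j; rewrite !ffunE.
      by case: eqP => // ->; rewrite bs.
    rewrite le_eqVlt; apply/orP; left; apply/eqP; apply: eq_bigl => b.
    apply/eqP/andP => [/ffunP hb|[/andP[/eqP/ffunP hb _] /eqP/ffunP hb']].
      split; last by apply/eqP/ffunP => j; move: (hb j); rewrite !ffunE own'E; case: (j =P s) => // ->; rewrite NpF.
      apply/andP; split; last by rewrite ffunE eqxx.
      apply/eqP/ffunP => j; move: (hb j); rewrite !ffunE own'E.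
      by case: (j =P s) => // ->; rewrite hs eqxx.
    apply/ffunP => j; move: (hb j) (hb' j); rewrite !ffunE own'E.
    by case: (j =P s) => // ->; rewrite NpF.
  have {qp} -> : q = ~~ p by case: q qp => //; case: (p).
  (* Receiver: tensoring with the basis state [v] preserves the norm. *)
  rewrite (bigID (fun b : Bits N => b s == v)) /= [X in _ + X]big1 ?addr0; last first.
    by move=> b /andP[_ /negbTE ->]; rewrite mul0r (sqnorm_bool false).
  rewrite [X in _ <= X](reindex_onto (set_bit s false) (set_bit s v)); last first.
    move=> b /eqP/ffunP hb; apply/ffunP => j; move: (hb j); rewrite !ffunE.
    by case: (j =P s) => // ->; rewrite hs; case: (p).
  rewrite le_eqVlt; apply/orP; left; apply/eqP; apply: eq_big => [b|b].
    apply/andP/andP => [[/eqP/ffunP hb /eqP bs]|[/eqP/ffunP hb /eqP/ffunP hb']].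
      split; apply/eqP/ffunP => j; move: (hb j); rewrite !ffunE own'E.
        by case: (j =P s) => // ->; rewrite hs; case: (p).
      by case: (j =P s) => // ->.
    have bs : b s = v by rewrite -(hb' s) !ffunE eqxx.
    split; last by rewrite bs.
    apply/eqP/ffunP => j; move: (hb j); rewrite !ffunE own'E.
    by case: (j =P s) => // ->; rewrite eqxx.
  by move=> /andP[_ ->]; rewrite mul1r.
rewrite he.
transitivity (\sum_i \sum_v
   gamma p i (if p then x else y) (set_bit s v (mask own' p b)) *
   ((mask own' (~~ p) b s == v)%:R *
    gamma (~~ p) i (if ~~ p then x else y) (set_bit s false (mask own' (~~ p) b))));
  last by rewrite pair_bigA; apply: eq_bigr => -[i v] _ /=; rewrite eqxx NpF.
apply: eq_bigr => i _.
have maskb v : (mask own' (~~ p) b s == v) = (b s == v).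
  by rewrite ffunE own'E eqxx eqxx.
have -> : mask own (~~ p) b = set_bit s false (mask own' (~~ p) b).
  by apply/ffunP => j; rewrite !ffunE own'E; case: (j =P s) => // ->; rewrite hs; case: (p).
have -> : mask own p b = set_bit s (b s) (mask own' p b).
  by apply/ffunP => j; rewrite !ffunE own'E; case: (j =P s) => // ->; rewrite hs eqxx.
rewrite (bigD1 (b s)) //= maskb eqxx mul1r big1 ?addr0 // => v vb.
by rewrite maskb eq_sym (negbTE vb) mul0r mulr0.
Qed.

Lemma split_state_run (rs : seq (round N)) own (I : finType) psi :
  valid_rounds own rs -> split_state own I psi ->
  exists2 J : finType, #|J| = (#|I| * 2 ^ size rs)%N &
    split_state (final_owner own rs) J (fun x y => run own (psi x y) rs).
Proof.
elim: rs own I psi => [|r rs IH] own I psi /=.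
  by move=> _ h; exists I; rewrite ?muln1.
case=> hs hU hv hpsi.
have [J cJ hJ] := IH _ _ _ hv (split_state_send hs (split_state_local hU hpsi)).
by exists J => //; rewrite cJ card_prod card_bool expnS mulnA.
Qed.

End SplitStates.

(** Each input qubit starts with the player whose input it holds, so the initial basis state is a
    product and one index suffices. *)
Lemma split_state_init (n : nat) (P : protocol n) :
  valid_protocol P ->
  split_state (p_own0 P) unit (fun x y b => (b == init_basis P x y)%:R).
Proof.
move=> [[_ _ _ hA hB] _].
pose ini (p : bool) (z : Bits n) : Bits (p_N P) :=
  [ffun i => [exists j, ((if p then p_inA P else p_inB P) j == i) && z j]].
exists (fun p _ z b => (b == ini p z)%:R); split=> [p i z|x y b].
  rewrite /player_sqnorm big_mkcond /=.
  apply: le_trans (_ : \sum_(b : Bits (p_N P)) (b == ini p z)%:R <= 1).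
    by apply: ler_sum => b _; rewrite sqnorm_bool; case: ifP.
  rewrite (bigD1 (ini p z)) //= eqxx big1 ?addr0 // => b /negbTE -> //.
rewrite big_const card_unit /= addr0 -natrM mulnb.
have h p z i : p_own0 P i = p -> ini (~~ p) z i = false.
  move=> hp; rewrite ffunE; apply: negbTE; rewrite negb_exists; apply/forallP => j.
  rewrite negb_and; apply/orP; left; apply/eqP => ij.
  by move: hp; rewrite -ij; case: p {ij} => /=; rewrite ?hA ?hB.
have initE i : init_basis P x y i = ini true x i || ini false y i by rewrite !ffunE.
have hm p : mask (p_own0 P) p (init_basis P x y) = ini p (if p then x else y).
  apply/ffunP => i; rewrite ffunE initE.
  case E: (p_own0 P i); case: p; rewrite ?(h true _ _ E) ?(h false _ _ E) ?orbF //.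
congr (nat_of_bool _)%:R; rewrite -(hm true) -(hm false).
apply/eqP/andP => [->|[/eqP h1 /eqP h2]]; first by rewrite !eqxx.
exact: (mask_inj h1 h2).
Qed.

Lemma split_state_final (n : nat) (P : protocol n) :
  valid_protocol P ->
  exists2 J : finType, #|J| = (2 ^ cost P)%N &
    split_state (final_owner (p_own0 P) (p_rounds P)) J (final_state P).
Proof.
move=> hP; have [_ [hv hU _]] := hP.
have [J cJ hJ] := split_state_run hv (split_state_init hP).
exists J; first by rewrite cJ card_unit mul1n.
by case: (split_state_local hU hJ) => gamma h; exists gamma.
Qed.

(** * Outcome probabilities and their projective norm *)

Lemma ReD (z t : R[i]) : complex.Re (z + t) = complex.Re z + complex.Re t.
Proof. by case: z; case: t. Qed.

Lemma ImD (z t : R[i]) : complex.Im (z + t) = complex.Im z + complex.Im t.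
Proof. by case: z; case: t. Qed.

Lemma Re_sum (I : finType) (A : pred I) (F : I -> R[i]) :
  complex.Re (\sum_(i | A i) F i) = \sum_(i | A i) complex.Re (F i).
Proof. exact: (big_morph _ ReD (erefl _)). Qed.

Lemma Im_sum (I : finType) (A : pred I) (F : I -> R[i]) :
  complex.Im (\sum_(i | A i) F i) = \sum_(i | A i) complex.Im (F i).
Proof. exact: (big_morph _ ImD (erefl _)). Qed.

Lemma ReM (z t : R[i]) :
  complex.Re (z * t) = complex.Re z * complex.Re t - complex.Im z * complex.Im t.
Proof. by case: z; case: t. Qed.

Lemma Re_mulJ_le (z t : R[i]) :
  `|complex.Re (z * conjc t)| <= (sqnorm z + sqnorm t) / 2.
Proof.
case: z => a b; case: t => c d; rewrite /sqnorm /= !RplusE mulrN opprK ler_norml.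
have := sqr_ge0 (a - c); have := sqr_ge0 (a + c).
have := sqr_ge0 (b - d); have := sqr_ge0 (b + d).
by move=> *; nra.
Qed.

Lemma Im_mulJ_le (z t : R[i]) :
  `|complex.Im (z * conjc t)| <= (sqnorm z + sqnorm t) / 2.
Proof.
case: z => a b; case: t => c d; rewrite /sqnorm /= !RplusE ler_norml.
have := sqr_ge0 (a - d); have := sqr_ge0 (a + d).
have := sqr_ge0 (b - c); have := sqr_ge0 (b + c).
by move=> *; nra.
Qed.

(** Cauchy-Schwarz for vectors of norm at most 1, obtained from AM-GM term by term; [A] is the
    diagonal projector of a measurement. *)
Lemma overlap_le (N : nat) (own : Bits N) p (A : pred (Bits N)) (phi chi : Bits N -> R[i]) :
  player_sqnorm own p phi <= 1 -> player_sqnorm own p chi <= 1 ->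
  `|complex.Re (\sum_(b | mask own p b == b) (A b)%:R * (phi b * conjc (chi b)))| <= 1 /\
  `|complex.Im (\sum_(b | mask own p b == b) (A b)%:R * (phi b * conjc (chi b)))| <= 1.
Proof.
move=> h1 h2.
have h : \sum_(b | mask own p b == b) (sqnorm (phi b) + sqnorm (chi b)) / 2 <= 1.
  rewrite -mulr_suml big_split /=; move: h1 h2; rewrite /player_sqnorm; lra.
have g0 b : 0 <= (sqnorm (phi b) + sqnorm (chi b)) / 2.
  by have := sqnorm_ge0 (phi b); have := sqnorm_ge0 (chi b); lra.
split; apply: le_trans h; rewrite ?Re_sum ?Im_sum; apply: le_trans (ler_norm_sum _ _ _) _;
  apply: ler_sum => b _; case: (A b); rewrite ?mul1r ?mul0r ?normr0 //;
  by [apply: Re_mulJ_le | apply: Im_mulJ_le].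
Qed.

(** Expanding the squared modulus of the final state gives [4 ^ cost P] pairs of indices. Each pair
    contributes the real part of a product of two overlaps, one for each player, and that is two
    rank-one real terms. *)
Lemma proj_norm_prob (n : nat) (P : protocol n) (X Y : finType)
    (xi : X -> Bits n) (eta : Y -> Bits n) (m : bool) :
  valid_protocol P ->
  proj_norm_le (2 * 4 ^+ cost P) (fun i j => prob_outcome P (xi i) (eta j) m).
Proof.
move=> hP; have [J cJ] := split_state_final hP.
have [_ [_ _ hout]] := hP; move: hout.
set own := final_owner _ _; set p := p_fin_player P => hout.
move=> /(split_stateP _ _ _ p)[gamma [hn he]].
pose A (b : Bits (p_N P)) := b (p_out P) == m.
(* The measured qubit belongs to [p], so the projector [A] enters [F] only. *)
pose F (ij : J * J) z := \sum_(b | mask own p b == b)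
   (A b)%:R * (gamma p ij.1 z b * conjc (gamma p ij.2 z b)).
pose G (ij : J * J) z := \sum_(b | mask own (~~ p) b == b)
   true%:R * (gamma (~~ p) ij.1 z b * conjc (gamma (~~ p) ij.2 z b)).
have probE x y : prob_outcome P x y m =
    \sum_ij (complex.Re (F ij (if p then x else y)) * complex.Re (G ij (if p then y else x))
           - complex.Im (F ij (if p then x else y)) * complex.Im (G ij (if p then y else x))).
  transitivity (complex.Re (\sum_(ij : J * J)
       F ij (if p then x else y) * G ij (if p then y else x))); last first.
    by rewrite Re_sum; apply: eq_bigr => ij _; rewrite ReM.
  rewrite /prob_outcome big_mkcond /=.
  transitivity (complex.Re (\sum_b (A b)%:R * (final_state P x y b * conjc (final_state P x y b)))).
    rewrite Re_sum; apply: eq_bigr => b _; rewrite /A sqnormE.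
    by case: eqP; rewrite ?mul1r ?mul0r.
  congr complex.Re.
  transitivity (\sum_b \sum_(ij : J * J)
     ((A (mask own p b))%:R * (gamma p ij.1 (if p then x else y) (mask own p b) *
         conjc (gamma p ij.2 (if p then x else y) (mask own p b)))) *
     (true%:R * (gamma (~~ p) ij.1 (if p then y else x) (mask own (~~ p) b) *
         conjc (gamma (~~ p) ij.2 (if p then y else x) (mask own (~~ p) b))))).
    apply: eq_bigr => b _.
    have -> : A (mask own p b) = A b by rewrite /A ffunE hout eqxx.
    rewrite he rmorph_sum /= big_distrlr /= pair_bigA mulr_sumr /=.
    apply: eq_bigr => -[i j] _ /=.
    by rewrite rmorphM /= if_neg; ring.
  rewrite exchange_big /=; apply: eq_bigr => ij _.
  exact: (@sum_mask _ _ own p (fun b => (A b)%:R *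
     (gamma p ij.1 _ b * conjc (gamma p ij.2 _ b))) (fun b => true%:R * _)).
have bF ij z := @overlap_le _ own p A _ _ (hn p ij.1 z) (hn p ij.2 z).
have bG ij z := @overlap_le _ own (~~ p) predT _ _ (hn (~~ p) ij.1 z) (hn (~~ p) ij.2 z).
apply: (@eq_proj_norm_le _ _ _ (fun i j =>
   \sum_(kl : J * J) (complex.Re (F kl (if p then xi i else eta j)) *
      complex.Re (G kl (if p then eta j else xi i))
   - complex.Im (F kl (if p then xi i else eta j)) *
      complex.Im (G kl (if p then eta j else xi i))))).
  by move=> i j; rewrite probE.
have -> : 2 * 4 ^+ cost P = #|{: J * J}|%:R * (1 + 1) :> R.
  rewrite card_prod cJ natrM natrX -exprMn (_ : 2 * 2 = 4); [ring | by rewrite -natrM].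
have rank1 (F' G' : Bits n -> R) : (forall z, `|F' z| <= 1) -> (forall z, `|G' z| <= 1) ->
    proj_norm_le 1 (fun i j => F' (if p then xi i else eta j) * G' (if p then eta j else xi i)).
  move=> hF hG; case: (p).
    by apply: (@proj_norm_rank1 _ _ (fun i => F' (xi i)) (fun j => G' (eta j))).
  apply: (@eq_proj_norm_le _ _ _ (fun i j => G' (xi i) * F' (eta j))).
    by move=> i j; rewrite mulrC.
  by apply: (@proj_norm_rank1 _ _ (fun i => G' (xi i)) (fun j => F' (eta j))).
apply: proj_norm_le_sum => kl.
apply: (@proj_norm_leD _ _ 1 1
  (fun i j => complex.Re (F kl (if p then xi i else eta j)) *
              complex.Re (G kl (if p then eta j else xi i)))
  (fun i j => - (complex.Im (F kl (if p then xi i else eta j)) *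
                 complex.Im (G kl (if p then eta j else xi i))))).
  apply: (rank1 (fun z => complex.Re (F kl z)) (fun z => complex.Re (G kl z))) => z.
    by case: (bF kl z).
  by case: (bG kl z).
apply: proj_norm_leN.
apply: (rank1 (fun z => complex.Im (F kl z)) (fun z => complex.Im (G kl z))) => z.
  by case: (bF kl z).
by case: (bG kl z).
Qed.

Lemma prob_outcome_ge0 (n : nat) (P : protocol n) x y m : 0 <= prob_outcome P x y m.
Proof. by apply: sumr_ge0 => b _; apply: sqnorm_ge0. Qed.

Lemma run_norm (N : nat) (rs : seq (round N)) (own : Bits N) (psi : Bits N -> R[i]) :
  valid_rounds own rs -> \sum_b sqnorm (run own psi rs b) = \sum_b sqnorm (psi b).
Proof.
elim: rs own psi => [|r rs IH] own psi //= [_ hU hv].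
by rewrite IH // unitary_norm.
Qed.

Lemma prob_outcome_total (n : nat) (P : protocol n) x y :
  valid_protocol P -> prob_outcome P x y false + prob_outcome P x y true = 1.
Proof.
move=> [_ [hv hU _]].
have -> : prob_outcome P x y false + prob_outcome P x y true =
    \sum_b sqnorm (final_state P x y b).
  rewrite [RHS](bigID (fun b : Bits (p_N P) => b (p_out P) == false)) /=; congr (_ + _).
  by apply: eq_bigl => b; case: (b _).
rewrite unitary_norm // run_norm // (bigD1 (init_basis P x y)) //= eqxx.
rewrite (sqnorm_bool true) big1 ?addr0 // => b /negbTE ->.
exact: (sqnorm_bool false).
Qed.

Lemma computes_approx (n : nat) (P : protocol n) (f : Bits n -> Bits n -> R) (m : nat) :
  (forall x y, f x y = 1 \/ f x y = -1) -> computes P f ->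
  exists g : Bits n -> Bits n -> R,
    (forall x y, `|f x y - g x y| <= 4 * (8 / 9) ^+ m) /\
    proj_norm_le (4 ^+ ((cost P).+1 * (2 * m).+1))
      (fun i j : 'I_(#|{: Bits n}|) => g (enum_val i) (enum_val j)).
Proof.
move=> hf [hP herr].
exists (fun x y => majority_bias m (prob_outcome P x y false) (prob_outcome P x y true)).
split=> [x y|].
  apply: majority_bias_error; rewrite ?prob_outcome_ge0 ?prob_outcome_total //.
  by move: (herr x y); rewrite /error_prob.
(* One factor 2 comes from the real and imaginary parts of the overlaps, the other from the majority
   vote. *)
rewrite exprM (_ : 4 ^+ (cost P).+1 = 2 * (2 * 4 ^+ cost P)); last by rewrite exprS; ring.
by apply: proj_norm_majority; apply: proj_norm_prob.
Qed.

(* Without communication the measuring player's reduced state, hence [f],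
   depends on that player's input only. *)
Lemma computes_cost0 (n : nat) (P : protocol n) (f : Bits n -> Bits n -> R) :
  (forall x y, f x y = 1 \/ f x y = -1) -> computes P f -> cost P = 0%N ->
  proj_norm_le 1 (fun i j : 'I_(#|{: Bits n}|) => f (enum_val i) (enum_val j)).
Proof.
move=> hf [hP herr] c0; have [J] := split_state_final hP.
rewrite c0 expn0 => /eqP/fintype1P[j0 Jj0].
have [_ [_ _ hout]] := hP; move: hout.
set own := final_owner _ _; set p := p_fin_player P => hout.
move=> /(split_stateP _ _ _ p)[gamma [_ he]].
pose a m z := \sum_(b | mask own p b == b)
  (b (p_out P) == m)%:R * sqnorm (gamma p j0 z b).
pose g z := \sum_(b | mask own (~~ p) b == b) sqnorm (gamma (~~ p) j0 z b).
have probE x y m :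
    prob_outcome P x y m = a m (if p then x else y) * g (if p then y else x).
  rewrite -(@sum_mask _ _ own p (fun b => (b (p_out P) == m)%:R * sqnorm (gamma p j0 _ b))
    (fun b => sqnorm (gamma (~~ p) j0 _ b))) /prob_outcome big_mkcond.
  apply: eq_bigr => b _; rewrite he (bigD1 j0) //= big1 => [|j]; last by rewrite (Jj0 j) eqxx.
  rewrite addr0 sqnormM ffunE hout eqxx if_neg.
  by case: eqP => _; rewrite ?mul0r ?mul1r.
(* Both outcome probabilities share the nonnegative factor [g], so [a] alone decides which outcome
   is likelier; the error bound excludes a tie. *)
pose phi z : R := if a true z <= a false z then 1 else -1.
have phi1 z : `|phi z| <= 1 by rewrite /phi; case: ifP; rewrite ?normrN normr1.
have fE x y : f x y = phi (if p then x else y).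
  have g0 : 0 <= g (if p then y else x) by apply: sumr_ge0 => b _; apply: sqnorm_ge0.
  have := herr x y; have := prob_outcome_total x y hP.
  rewrite /error_prob /phi !probE.
  case: (hf x y) => ->.
    rewrite eqxx => h1 h2; case: leP => // /ltW; rewrite -subr_ge0 => h.
    by have := mulr_ge0 h g0; rewrite mulrBl; lra.
  have -> : (-1 == 1 :> R) = false by apply/eqP; lra.
  move=> h1 h2; case: leP => //; rewrite -subr_ge0 => h.
  by have := mulr_ge0 h g0; rewrite mulrBl; lra.
case: (p) fE => fE.
  apply: (@eq_proj_norm_le _ _ _ (fun i j => phi (enum_val i) * 1)).
    by move=> i j; rewrite mulr1 fE.
  by apply: (@proj_norm_rank1 _ _ (fun i => phi (enum_val i)) (fun=> 1)) => [i|j];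
    rewrite ?phi1 ?normr1.
apply: (@eq_proj_norm_le _ _ _ (fun i j => 1 * phi (enum_val j))).
  by move=> i j; rewrite mul1r fE.
by apply: (@proj_norm_rank1 _ _ (fun=> 1) (fun j => phi (enum_val j))) => [i|j];
  rewrite ?phi1 ?normr1.
Qed.

(** * A protocol for every function *)

Section TrivialProtocol.
Variables (n : nat) (f : Bits n -> Bits n -> R).

Let N := (n + n).+1.

Definition triv_inA (j : 'I_n) : 'I_N := widen_ord (leqnSn _) (lshift n j).
Definition triv_inB (j : 'I_n) : 'I_N := widen_ord (leqnSn _) (rshift n j).
Definition triv_own0 : Bits N := [ffun i : 'I_N => (i < n)%N].

Definition triv_round (j : 'I_n) : round N :=
  @Round N true (fun b c => (b == c)%:R) (triv_inA j).

(** Bob's reversible evaluation of [f] into the spare qubit [ord_max]. Since [f] does not read that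
    qubit, the map is an involution, hence a unitary. *)
Definition triv_flip (c : Bits N) : Bits N :=
  [ffun i : 'I_N => if i == ord_max
                     then c i (+) (f [ffun j => c (triv_inA j)] [ffun j => c (triv_inB j)] != 1)
                     else c i].

(** Alice sends her [n] input qubits unchanged; Bob then holds every qubit. *)
Definition triv_protocol : protocol n :=
  @Protocol n N triv_inA triv_inB triv_own0 [seq triv_round j | j <- enum 'I_n]
    false (fun b c => (b == triv_flip c)%:R) ord_max.

Lemma triv_inA_max j : (triv_inA j == ord_max) = false.
Proof. by apply/eqP => /(congr1 val) /=; have := ltn_ord j; lia. Qed.

Lemma triv_inB_max j : (triv_inB j == ord_max) = false.
Proof. by apply/eqP => /(congr1 val) /=; have := ltn_ord j; lia. Qed.

Lemma triv_flipK : involutive triv_flip.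
Proof.
move=> c; apply/ffunP => i.
have flip_in (k : 'I_n -> 'I_N) : (forall j, (k j == ord_max) = false) ->
    [ffun j => triv_flip c (k j)] = [ffun j => c (k j)] :> Bits n.
  by move=> hk; apply/ffunP => j; rewrite !ffunE hk.
rewrite ffunE (flip_in _ triv_inA_max) (flip_in _ triv_inB_max) ffunE.
by case: eqP => // _; rewrite addbK.
Qed.

Lemma local_op_id (own : Bits N) p b c :
  local_op own p (fun b c => (b == c)%:R) b c = (b == c)%:R.
Proof.
rewrite /local_op; case: ifP => [/forallP h|/negbT].
  congr (nat_of_bool _)%:R; apply/eqP/eqP => [/ffunP hb|->//].
  apply/ffunP => i; move: (h i) (hb i); rewrite !ffunE.
  by case: eqP => //= _ /eqP.
by case: (b =P c) => // ->; move=> /negP[]; apply/forallP => i; rewrite eqxx implybT.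
Qed.

Lemma apply_id (U : Bits N -> Bits N -> R[i]) (psi : Bits N -> R[i]) b :
  (forall b c, U b c = (b == c)%:R) -> apply_op U psi b = psi b.
Proof.
move=> hU; rewrite /apply_op (bigD1 b) //= hU eqxx mul1r big1 ?addr0 // => c cb.
by rewrite hU eq_sym (negbTE cb) mul0r.
Qed.

Lemma unitary_perm (U : Bits N -> Bits N -> R[i]) (pi : Bits N -> Bits N) :
  involutive pi -> (forall b c, U b c = (b == pi c)%:R) -> unitary U.
Proof.
move=> piK hU b b'; rewrite (bigD1 (pi b)) //= !hU piK eqxx mul1r big1 => [|c cb].
  by rewrite addr0 eq_sym; case: (_ == _); rewrite ?conjc1 ?conjc0.
rewrite hU (_ : (b == pi c) = false) ?mul0r //.
by apply/eqP => bc; rewrite bc piK eqxx in cb.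
Qed.

Lemma triv_rounds_valid (own : Bits N) (js : seq 'I_n) :
  uniq js -> (forall j, j \in js -> own (triv_inA j) = true) ->
  valid_rounds own [seq triv_round j | j <- js].
Proof.
elim: js own => [|j js IH] own //= /andP[jjs ujs] hown; split.
- by rewrite hown ?mem_head.
- by apply: (@unitary_perm _ id) => // b c; rewrite local_op_id.
apply: IH => // k kjs; rewrite ffunE /= hown ?inE ?kjs ?orbT //.
case: eqP => // /(congr1 val) /= kj.
by move: jjs; rewrite -(_ : k = j) ?kjs //; apply: val_inj.
Qed.

Lemma triv_final_owner (own : Bits N) (js : seq 'I_n) i :
  final_owner own [seq triv_round j | j <- js] i =
  if i \in [seq triv_inA j | j <- js] then false else own i.
Proof.
elim: js own => [|j js IH] own //=.
by rewrite IH inE ffunE /=; case: eqP => //= _; case: ifP.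
Qed.

Lemma triv_run (own : Bits N) (js : seq 'I_n) psi :
  run own psi [seq triv_round j | j <- js] =1 psi.
Proof.
elim: js own psi => [|j js IH] own psi //= b.
by rewrite IH apply_id // => b' c; rewrite local_op_id.
Qed.

Lemma triv_computes :
  (forall x y, f x y = 1 \/ f x y = -1) -> computes triv_protocol f.
Proof.
move=> hf.
have inA_inj : injective triv_inA.
  by move=> j k /(congr1 val) /= jk; apply: val_inj.
have inB_inj : injective triv_inB.
  by move=> j k /(congr1 val) /= /addnI jk; apply: val_inj.
have AB j k : triv_inA j != triv_inB k.
  by apply/eqP => /(congr1 val) /=; have := ltn_ord j; lia.
have ownF i : final_owner triv_own0 [seq triv_round j | j <- enum 'I_n] i = false.
  rewrite triv_final_owner ffunE; case: ifP => // /negbT hi.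
  apply/negbTE/negP => lt_in; case/negP: hi; apply/mapP.
  by exists (Ordinal lt_in); rewrite ?mem_enum //; apply: val_inj.
have maskF b : mask (final_owner triv_own0 [seq triv_round j | j <- enum 'I_n]) false b = b.
  by apply/ffunP => i; rewrite ffunE ownF.
have finE b c : local_op (final_owner triv_own0 [seq triv_round j | j <- enum 'I_n]) false
    (fun b c => (b == triv_flip c)%:R) b c = (b == triv_flip c)%:R.
  rewrite /local_op !maskF ifT //; apply/forallP => i; by rewrite ownF.
split.
  split; split=> //=.
  - by move=> j; rewrite ffunE /= ltn_ord.
  - by move=> j; rewrite ffunE /= ltnNge leq_addr.
  - apply: triv_rounds_valid; first exact: enum_uniq.
    by move=> j _; rewrite ffunE /= ltn_ord.
  - exact: (unitary_perm triv_flipK).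
move=> x y.
pose v := triv_flip (init_basis triv_protocol x y).
have finalE b : final_state triv_protocol x y b = (b == v)%:R.
  rewrite /final_state /apply_op /= (bigD1 (init_basis triv_protocol x y)) //=.
  rewrite finE triv_run eqxx mulr1 big1 ?addr0 // => c cb.
  by rewrite triv_run (negbTE cb) mulr0.
have initA j : init_basis triv_protocol x y (triv_inA j) = x j.
  rewrite ffunE /= [X in _ || X](_ : _ = false).
    rewrite orbF; apply/existsP/idP => [[k /andP[/eqP/inA_inj->]]//|xj].
    by exists j; rewrite eqxx.
  by apply: negbTE; rewrite negb_exists; apply/forallP => k; rewrite eq_sym (negbTE (AB j k)).
have initB j : init_basis triv_protocol x y (triv_inB j) = y j.
  rewrite ffunE /= [X in X || _](_ : _ = false).
    apply/existsP/idP => [[k /andP[/eqP/inB_inj->]]//|xj].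
    by exists j; rewrite eqxx.
  by apply: negbTE; rewrite negb_exists; apply/forallP => k; rewrite (negbTE (AB k j)).
have initM : init_basis triv_protocol x y ord_max = false.
  rewrite ffunE /=; apply: negbTE; rewrite negb_or !negb_exists.
  by apply/andP; split; apply/forallP => k; rewrite ?triv_inA_max ?triv_inB_max.
have vM : v ord_max = (f x y != 1).
  rewrite ffunE eqxx initM.
  have -> : [ffun j => init_basis triv_protocol x y (triv_inA j)] = x.
    by apply/ffunP => j; rewrite ffunE initA.
  have -> // : [ffun j => init_basis triv_protocol x y (triv_inB j)] = y.
    by apply/ffunP => j; rewrite ffunE initB.
have prob0 : prob_outcome triv_protocol x y (f x y == 1) = 0.
  rewrite /prob_outcome /= big1 // => b hb; rewrite finalE sqnorm_bool.
  by case: eqP => // bv; move: hb; rewrite bv /= vM; case: (f x y == 1).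
rewrite /error_prob; case: (f x y == 1) prob0 => ->; lra.
Qed.

End TrivialProtocol.

(** A lower bound passes to the infimum because the set of costs is nonempty, as the trivial
    protocol shows. *)
Lemma BQC_ge (n : nat) (f : Bits n -> Bits n -> R) (v : R) :
  (forall x y, f x y = 1 \/ f x y = -1) ->
  (forall P : protocol n, computes P f -> v <= (cost P)%:R) -> v <= BQC f.
Proof.
move=> hf hv; apply: lb_le_inf.
  by exists (cost (triv_protocol f))%:R, (triv_protocol f); split=> //; apply: triv_computes.
by move=> _ [P [hP ->]]; apply: hv.
Qed.

(** * Lower bounds *)

Lemma log2E x : log2 x = ln x * (ln 2)^-1.
Proof. by rewrite /log2 RdivE. Qed.

Lemma ln2_gt_half : 1 / 2 < ln 2.
Proof. by apply/RltP; rewrite -[X in Rlt X]RdivE; have := ln_lt_2; rewrite /Rdiv Rmult_1_l. Qed.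

Lemma log2_1 : log2 1%R = 0.
Proof. by rewrite log2E ln_1 mul0r. Qed.

Lemma log2_2 : log2 2%:R = 1.
Proof. by rewrite log2E divff // gt_eqF //; have := ln2_gt_half; lra. Qed.

Lemma log2M x y : 0 < x -> 0 < y -> log2 (x * y)%R = log2 x + log2 y.
Proof.
move=> /RltP x0 /RltP y0; rewrite !log2E -mulrDl; congr (_ * _).
exact: ln_mult.
Qed.

(* [ln] vanishes on nonpositive arguments. *)
Lemma log2_npos x : x <= 0 -> log2 x = 0.
Proof.
move=> /RleP x0; rewrite log2E /ln; case: Rlt_dec => [h|_]; last by rewrite mul0r.
by case: (Rlt_not_le _ _ h).
Qed.

Lemma le_log2 x y : 0 < x -> x <= y -> log2 x <= log2 y.
Proof.
move=> /RltP x0; rewrite le_eqVlt => /predU1P[->//|/RltP xy].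
rewrite !log2E; apply: ler_wpM2r.
  by rewrite invr_ge0; have := ln2_gt_half; lra.
by apply/ltW/RltP; apply: ln_increasing.
Qed.

Lemma log2V x : 0 < x -> log2 x^-1%R = - log2 x.
Proof.
move=> x0; have := log2M x0 (_ : 0 < x^-1); rewrite invr_gt0 => /(_ x0).
by rewrite divff ?gt_eqF // log2_1 => h; lra.
Qed.

Lemma log2X x k : 0 < x -> log2 (x ^+ k) = k%:R * log2 x.
Proof.
move=> x0; elim: k => [|k IH]; first by rewrite expr0 log2_1 mul0r.
by rewrite exprS log2M ?exprn_gt0 // IH -[k.+1%:R]natr1; ring.
Qed.

Lemma log2_le_sub1 x : 1 <= x -> log2 x <= 2 * (x - 1).
Proof.
move=> x1; rewrite log2E.
have x0 : 0 < x by lra.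
have h : ln x <= x - 1.
  have /RleP := exp_ineq1_le (ln x); rewrite exp_ln; last by apply/RltP.
  by rewrite RplusE R1E => h; lra.
have i2 : (ln 2)^-1 <= 2.
  by rewrite invf_ple ?posrE; have := ln2_gt_half; lra.
have i0 : 0 <= (ln 2)^-1 by rewrite invr_ge0; have := ln2_gt_half; lra.
apply: le_trans (ler_wpM2r i0 h) _.
by rewrite mulrC; apply: ler_wpM2r => //; lra.
Qed.

(** Turns a required accuracy into the integer parameter [j] of the vote, losing at most 1 in the
    logarithm. *)
Lemma exists_pow2_ge t : 1 <= t ->
  exists j : nat, t <= 2 ^+ j /\ j%:R <= log2 t + 1.
Proof.
move=> t1.
have t0 : 0 < t by lra.
have l0 : 0 <= log2 t by rewrite -log2_1; apply: le_log2.
have /andP[h1 h2] := truncn_itv l0.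
exists (Num.truncn (log2 t)).+1; split; last by rewrite -natr1 lerD2r.
rewrite leNgt; apply/negP => h.
have := le_log2 (exprn_gt0 _ (ltr0n _ 2)) (ltW h).
by rewrite log2X ?ltr0n // log2_2 mulr1 leNgt h2.
Qed.

(** Since [(8 / 9) ^ 6 < 1 / 2], a vote with [m = 6 * j] has error at most [4 / 2 ^ j]. *)
Lemma pow89_le j : (8 / 9) ^+ (6 * j) <= (2 ^+ j)^-1 :> R.
Proof.
rewrite exprM -exprVn; apply: lerXn2r; rewrite ?nnegrE.
- by apply: exprn_ge0; lra.
- by rewrite invr_ge0; lra.
by rewrite !exprS expr0; lra.
Qed.

(** * Bounds on the cost of a single protocol *)

Section LowerBounds.
Variables (n : nat) (f : Bits n -> Bits n -> R) (s : seq R).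
Hypotheses (hf : forall x y, f x y = 1 \/ f x y = -1)
           (hs : singular_values (Mf f) s).

Let M := #|{: Bits n}|.

Lemma protocol_test (P : protocol n) (j : nat) (delta lam : R) (w : 'I_M -> R) :
  computes P f -> 0 <= delta -> (forall l, 0 <= w l <= delta) -> 0 < lam ->
  \sum_(l < M) s`_l * w l <=
    (lam * (4 / 2 ^+ j) ^+ 2 + (\sum_l w l ^+ 2) / lam) / 2
    + 4 ^+ ((cost P).+1 * (12 * j).+1) * delta.
Proof.
move=> hP delta0 hw lam0.
have [g [hg hT]] := computes_approx (6 * j) hf hP.
have -> : (12 * j).+1 = (2 * (6 * j)).+1 by lia.
apply: spectral_test hs _ hT delta0 hw lam0 => x y.
apply: le_trans (hg x y) _.
by have := pow89_le j; lra.
Qed.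

(** Here [f] is its own approximant with error 0, so a large [lam] makes the Frobenius term as small
    as desired. *)
Lemma cost0_test (P : protocol n) (w : 'I_M -> R) :
  computes P f -> cost P = 0%N -> (forall l, 0 <= w l <= 1) ->
  \sum_(l < M) s`_l * w l <= 1.
Proof.
move=> hP c0 hw.
have hT := computes_cost0 hf hP c0.
have hff x y : `|f x y - f x y| <= 0 by rewrite subrr normr0.
set S := \sum_(l < M) _; set W := \sum_l w l ^+ 2.
have W0 : 0 <= W by apply: sumr_ge0 => l _; apply: sqr_ge0.
rewrite leNgt; apply/negP => S1.
(* This [lam] brings [W / lam] below [S - 1], so the test gives [S <= (S - 1) / 2 + 1], which
   contradicts [1 < S]. The [+ 1] covers [W = 0]. *)
have lam0 : 0 < (W + 1) / (S - 1) by apply: divr_gt0; lra.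
have := spectral_test hs hff hT ler01 hw lam0; rewrite -/S -/W expr0n /= mulr0 add0r.
have -> : W / ((W + 1) / (S - 1)) = (S - 1) * (W / (W + 1)).
  by field; apply/andP; split; rewrite gt_eqF //; lra.
have : W / (W + 1) <= 1 by rewrite ler_pdivrMr; lra.
move=> h1 h2; have S0 : 0 <= S - 1 by lra.
by have := ler_wpM2l S0 h1; lra.
Qed.

Lemma singular_value_ge0 l : 0 <= s`_l.
Proof.
case: hs => sz s0 _ _; have [lM|] := ltnP l M; first exact: s0.
by move=> h; rewrite nth_default ?sz.
Qed.

Lemma singular_value_le1 (l : 'I_M) : s`_l <= 1.
Proof.
have := singular_values_sqr_sum hf hs; rewrite (bigD1 l) //= => h.
have : 0 <= \sum_(i < M | i != l) s`_i ^+ 2 by apply: sumr_ge0 => i _; apply: sqr_ge0.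
by have := singular_value_ge0 l; nra.
Qed.

Lemma kappaE k : kappa s k = \sum_(l < M) s`_l * (l < k)%:R.
Proof.
case: hs => sz _ _ _.
(* [k] may exceed [M]: both sums are extended to [maxn k M], and [nth] returns 0 past the end of
   [s]. *)
rewrite /kappa (big_ord_widen (maxn k M) (fun i => s`_i)) ?leq_maxl //.
rewrite (big_ord_widen (maxn k M) (fun i => s`_i * (i < k)%:R)) ?leq_maxr //.
rewrite big_mkcond [RHS]big_mkcond; apply: eq_bigr => i _.
case: (ltnP i M) => iM; first by case: ifP; rewrite ?mulr1 ?mulr0.
by rewrite nth_default ?sz //; case: ifP.
Qed.

Lemma indicator_sqr_sum_le k : \sum_(l < M) ((l < k)%:R : R) ^+ 2 <= k%:R.
Proof.
rewrite (big_ord_widen (maxn k M) (fun i => ((i < k)%:R : R) ^+ 2)) ?leq_maxr //.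
have -> : k%:R = \sum_(i < k) 1 :> R by rewrite sumr_const card_ord.
rewrite (big_ord_widen (maxn k M) (fun=> 1)) ?leq_maxl //.
rewrite big_mkcond [leRHS]big_mkcond; apply: ler_sum => i _.
by case: (i < M)%N; case: (i < k)%N; rewrite ?expr1n ?expr0n //=; lra.
Qed.

(** Cauchy-Schwarz against the indicator of the first [k] indices, as AM-GM with weight [q], using
    that the squares of the singular values sum to 1. *)
Lemma kappa_le_sqrt k : (1 <= k)%N -> kappa s k <= Num.sqrt k%:R.
Proof.
move=> k1; set q := Num.sqrt _.
have q0 : 0 < q by rewrite sqrtr_gt0 ltr0n.
have qq : q ^+ 2 = k%:R by rewrite sqr_sqrtr ?ler0n.
rewrite kappaE.
apply: le_trans (_ : \sum_(l < M) (q * s`_l ^+ 2 + ((l < k)%:R) ^+ 2 / q) / 2 <= _).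
  apply: ler_sum => l _; rewrite -subr_ge0; set v := _%:R.
  have -> : (q * s`_l ^+ 2 + v ^+ 2 / q) / 2 - s`_l * v = q / 2 * (s`_l - v / q) ^+ 2.
    by field; rewrite gt_eqF.
  by rewrite mulr_ge0 ?sqr_ge0 //; lra.
rewrite -mulr_suml big_split /= -mulr_sumr (singular_values_sqr_sum hf hs) -mulr_suml.
have : (\sum_(l < M) ((l < k)%:R) ^+ 2) / q <= q.
  by rewrite ler_pdivrMr // -expr2 qq indicator_sqr_sum_le.
by lra.
Qed.

Lemma kappa_cost (P : protocol n) k : computes P f -> (1 <= k)%N -> 1 < kappa s k ->
  log2 (kappa s k) <=
    197 * ((cost P)%:R * (log2 (Num.sqrt k%:R) - log2 (kappa s k) + 1)).
Proof.
move=> hP k1 ka1.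
have kaq := kappa_le_sqrt k1; have kaw := kappaE k.
have hw (l : 'I_M) : 0 <= ((l < k)%:R : R) <= 1.
  by case: (_ < _)%N; rewrite ?lexx ?ler01.
have c1 : (1 <= cost P)%N.
  rewrite lt0n; apply/eqP => c0; have := cost0_test hP c0 hw.
  by rewrite -kaw; lra.
move: kaq kaw ka1; set ka := kappa s k; set q := Num.sqrt _ => kaq kaw ka1.
have q0 : 0 < q by lra.
have qq : q ^+ 2 = k%:R by rewrite sqr_sqrtr ?ler0n.
(* The factor 8 yields [eps * q <= ka / 2] for the error [eps = 4 / 2 ^ j]. *)
have t1 : 1 <= 8 * (q / ka).
  have : 1 <= q / ka by rewrite ler_pdivlMr; lra.
  by lra.
have [j [hj1 hj2]] := exists_pow2_ge t1.
have p0 : 0 < 2 ^+ j :> R by rewrite exprn_gt0 // ltr0n.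
set L := log2 q - log2 ka.
have L0 : 0 <= L by rewrite subr_ge0 le_log2 //; lra.
(* 3 is the logarithm of 8 and 1 is the rounding. *)
have hj : j%:R <= L + 4.
  move: hj2; rewrite log2M ?ltr0n ?divr_gt0 //; try lra.
  rewrite log2M ?invr_gt0 //; try lra.
  rewrite log2V; try lra.
  have -> : log2 8%:R = 3.
    by rewrite (_ : 8 = 2 ^+ 3) ?log2X ?ltr0n // ?log2_2 ?mulr1 //; ring.
  by rewrite /L; lra.
(* With this weight the error term equals [eps * q] and the weight term is at most that, so
   [ka <= ka / 2 + T]. *)
pose lam := q / (4 / 2 ^+ j).
have lam0 : 0 < lam by rewrite /lam !divr_gt0.
have := protocol_test j hP ler01 hw lam0; rewrite -kaw mulr1.
set T := 4 ^+ _ => main.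
have T0 : 0 < T by rewrite exprn_gt0 // ltr0n.
have kaT : ka <= 2 * T.
  have e1 : lam * (4 / 2 ^+ j) ^+ 2 <= ka / 2.
    have -> : lam * (4 / 2 ^+ j) ^+ 2 = q * 4 / 2 ^+ j by rewrite /lam; field; rewrite gt_eqF.
    rewrite ler_pdivrMr //; have := hj1; rewrite mulrA ler_pdivrMr; lra.
  have e2 : (\sum_(l < M) ((l < k)%:R) ^+ 2) / lam <= ka / 2.
    apply: le_trans (_ : k%:R / lam <= _).
      by apply: ler_wpM2r; [rewrite invr_ge0 ltW | apply: indicator_sqr_sum_le].
    have -> : k%:R / lam = q * 4 / 2 ^+ j.
      by rewrite /lam -qq; field; apply/andP; split; rewrite gt_eqF.
    rewrite ler_pdivrMr //; have := hj1; rewrite mulrA ler_pdivrMr; lra.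
  by lra.
have lka : log2 ka <= 1 + 2 * (((cost P).+1 * (12 * j).+1)%N)%:R.
  apply: le_trans (le_log2 _ kaT) _; first lra.
  rewrite log2M ?ltr0n // log2_2 lerD2l /T (_ : 4 = 2 ^+ 2); last by ring.
  by rewrite -exprM log2X ?ltr0n // log2_2 mulr1 natrM.
move: lka; rewrite natrM -[(cost P).+1%:R]natr1 -[(12 * j).+1%:R]natr1 natrM.
have : 1 <= (cost P)%:R :> R by rewrite ler1n.
move: ((cost P)%:R : R) (j%:R : R) hj (ler0n R j) => c jr hj jr0 c1' lka.
apply: le_trans lka _.
(* As [c >= 1], the total is at most [1 + 4 c (12 L + 49) <= 197 c (L + 1)]. *)
have : (c + 1) * (12 * jr + 1) <= (2 * c) * (12 * (L + 4) + 1).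
  by apply: ler_pM; lra.
have : 0 <= c * L by rewrite mulr_ge0; lra.
by move=> h1 h2; nra.
Qed.

Lemma xlog2x_sqr a : 0 < a -> - xlog2x (a ^+ 2) = a ^+ 2 * (2 * log2 a^-1).
Proof.
move=> a0; rewrite /xlog2x expf_eq0 /= gt_eqF // log2X // log2V //.
ring.
Qed.

(** This is [log2 x <= 2 (x - 1)] at [x = 1 / a]. It serves both for cost 0 and for singular values
    below [2 ^ -n]. *)
Lemma entropy_term_cost0 a : 0 <= a <= 1 -> - xlog2x (a ^+ 2) <= 4 * (a - a ^+ 2).
Proof.
move=> /andP[a0 a1]; have [->|an0] := eqVneq a 0.
  rewrite /xlog2x expr0n /= eqxx; lra.
have {an0} a0 : 0 < a by rewrite lt_def an0.
rewrite xlog2x_sqr //.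
have /log2_le_sub1 h : 1 <= a^-1 by rewrite invf_ge1.
have -> : 4 * (a - a ^+ 2) = a ^+ 2 * (2 * (2 * (a^-1 - 1))) by field; rewrite gt_eqF.
by apply: ler_wpM2l; [apply: sqr_ge0 | lra].
Qed.

(** The three summands answer three ranges: [log2 (1 / a) <= log2 (1 / delta)] for [a >= delta],
    [log2 (1 / a) <= n] for [a] between [2 ^ -n] and [delta], and the bound [4 a] below both. The
    last summand totals 4 over all [2 ^ n] indices. *)
Lemma entropy_term a delta : 0 <= a <= 1 -> 0 < delta <= 1 ->
  - xlog2x (a ^+ 2) <= 2 * log2 delta^-1 * a ^+ 2
    + 2 * n%:R * (a * (if a < delta then a else 0)) + 4 / 2 ^+ n.
Proof.
move=> /andP[a0 a1] /andP[d0 d1].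
have l0 : 0 <= log2 delta^-1.
  by rewrite -log2_1; apply: le_log2; rewrite ?invf_ge1 // ltr01.
have p0 : 0 < 2 ^+ n :> R by rewrite exprn_gt0 // ltr0n.
have p0' : 0 <= 4 / 2 ^+ n :> R by apply: divr_ge0; [lra | exact: ltW].
have n0 := ler0n R n.
have B0 : 0 <= 2 * log2 delta^-1 * a ^+ 2 by apply: mulr_ge0; [lra | exact: sqr_ge0].
have [ad|da] := ltP a delta; last first.
  have a_gt0 : 0 < a by lra.
  rewrite xlog2x_sqr // mulrC !mulr0 addr0.
  apply: le_trans (_ : 2 * log2 delta^-1 * a ^+ 2 <= _); last by lra.
  apply: ler_wpM2r; first exact: sqr_ge0.
  by have := le_log2 (_ : 0 < a^-1) (_ : a^-1 <= delta^-1); rewrite invr_gt0 lef_pV2 ?posrE //; lra.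
have [pa|ap] := leP (2 ^+ n)^-1 a.
  have a_gt0 : 0 < a by apply: lt_le_trans pa; rewrite invr_gt0.
  have h : log2 a^-1 <= n%:R.
    have -> : n%:R = log2 (2 ^+ n) by rewrite log2X ?ltr0n // log2_2 mulr1.
    by apply: le_log2; rewrite ?invr_gt0 // invf_ple ?posrE.
  have : a ^+ 2 * (2 * log2 a^-1) <= a ^+ 2 * (2 * n%:R).
    by apply: ler_wpM2l; [apply: sqr_ge0 | lra].
  by rewrite xlog2x_sqr // -expr2 => h'; lra.
have := entropy_term_cost0 (_ : 0 <= a <= 1); rewrite a0 a1 => /(_ isT) h.
have : 0 <= 2 * n%:R * (a * a) by apply: mulr_ge0; [lra | rewrite mulr_ge0].
have := sqr_ge0 a; lra.
Qed.

Lemma entropy_sqE : entropy_sq s = \sum_(l < M) - xlog2x (s`_l ^+ 2).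
Proof.
case: hs => sz _ _ _.
by rewrite /entropy_sq (big_nth 0) sz big_mkord sumrN.
Qed.

Lemma entropy_cost (P : protocol n) : computes P f -> (2 <= n)%N ->
  entropy_sq s <= 404 * ((cost P)%:R * log2 n%:R).
Proof.
move=> hP n2; rewrite entropy_sqE.
have s01 (l : 'I_M) : 0 <= s`_l <= 1.
  by rewrite singular_value_ge0 singular_value_le1.
have ssum := singular_values_sqr_sum hf hs; rewrite -/M in ssum.
(* For cost 0 the singular values sum to at most 1, as their squares do, so the termwise bounds
   [4 (a - a ^ 2)] add up to at most 0. *)
have [c0|c1] := posnP (cost P).
  have := @cost0_test P (fun=> 1) hP c0 (fun=> _); rewrite ler01 lexx => /(_ (fun=> isT)).
  under eq_bigr do rewrite mulr1.
  move=> ssum1; rewrite c0 mul0r mulr0.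
  apply: le_trans (_ : \sum_(l < M) 4 * (s`_l - s`_l ^+ 2) <= _).
    by apply: ler_sum => l _; apply: entropy_term_cost0.
  by rewrite -mulr_sumr big_split /= sumrN ssum; lra.
have nR : 2 <= n%:R :> R by rewrite ler_nat.
have l1 : 1 <= log2 n%:R.
  by have := @le_log2 2%:R n%:R; rewrite log2_2; apply; lra.
(* The factor 4 brings the error [4 / 2 ^ j] below [1 / n]. *)
have t1 : 1 <= 4 * n%:R :> R by lra.
have [j [hj1 hj2]] := exists_pow2_ge t1.
have p0 : 0 < 2 ^+ j :> R by rewrite exprn_gt0 // ltr0n.
have hj : j%:R <= log2 n%:R + 3.
  move: hj2; rewrite log2M ?ltr0n //; last by lia.
  have -> : log2 4%:R = 2.
    by rewrite (_ : 4 = 2 ^+ 2) ?log2X ?ltr0n // ?log2_2 ?mulr1 //; ring.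
  by lra.
pose T : R := (4 ^+ ((cost P).+1 * (12 * j).+1))%R.
have T1 : 1 <= T by rewrite exprn_ege1 //; lra.
have nT : 1 <= n%:R * T by nra.
(* Chosen so that [T * delta = 1 / n]. *)
pose delta := (n%:R * T)^-1.
have d0 : 0 < delta by rewrite invr_gt0; lra.
have d1 : delta <= 1 by rewrite invf_le1; lra.
pose w (l : 'I_M) := if s`_l < delta then s`_l else 0.
have hw l : 0 <= w l <= delta.
  rewrite /w; case: ltP => h; first by rewrite singular_value_ge0 ltW.
  by rewrite lexx ltW.
(* With [lam = 1] the squared norm of [w] equals the tested sum [S], so half of [S] is absorbed and
   [S <= eps ^ 2 + 2 / n], where [eps = 4 / 2 ^ j]. *)
have := protocol_test j hP (ltW d0) hw ltr01; rewrite -/T.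
have -> : \sum_l w l ^+ 2 = \sum_(l < M) s`_l * w l.
  by apply: eq_bigr => l _; rewrite /w; case: ifP; rewrite ?expr0n ?mulr0 ?expr2.
set S := \sum_(l < M) _; rewrite mul1r divr1 => main.
have hS : S <= 3 / n%:R.
  have e1 : (4 / 2 ^+ j) ^+ 2 <= 1 / n%:R :> R.
    have u0 : 0 <= 4 / 2 ^+ j :> R by apply: divr_ge0; [lra | exact: ltW].
    have uv : 4 / 2 ^+ j <= 1 / n%:R :> R.
      by rewrite ler_pdivrMr // mulrAC ler_pdivlMr; lra.
    have v1 : 1 / n%:R <= 1 :> R by rewrite ler_pdivrMr; lra.
    apply: le_trans (_ : (4 / 2 ^+ j) * 1 <= _); last by rewrite mulr1.
    by rewrite expr2; apply: ler_wpM2l => //; apply: le_trans v1.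
  have e2 : T * delta = 1 / n%:R.
    by rewrite /delta; field; apply/andP; split; rewrite gt_eqF; lra.
  have -> : 3 / n%:R = 1 / n%:R + 2 * (1 / n%:R) :> R by field; rewrite gt_eqF; lra.
  by move: main; rewrite e2; lra.
(* 10 is 6 from [2 n S] plus 4 from the terms [4 / 2 ^ n]. *)
have H1 : \sum_(l < M) - xlog2x (s`_l ^+ 2) <= 2 * log2 (n%:R * T)%R + 10.
  apply: le_trans (_ : \sum_(l < M) (2 * log2 delta^-1 * s`_l ^+ 2
      + 2 * n%:R * (s`_l * w l) + 4 / 2 ^+ n) <= _).
    by apply: ler_sum => l _; apply: entropy_term; rewrite ?d0.
  rewrite !big_split /= -!mulr_sumr ssum -/S sumr_const card_ord /delta invrK.
  have -> : 2 ^- n *+ M = 1 :> R.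
    by rewrite -[LHS]mulr_natr /M card_Bits natrX mulVf // gt_eqF // exprn_gt0 // ltr0n.
  have : 2 * n%:R * S <= 6.
    apply: le_trans (_ : 2 * n%:R * (3 / n%:R) <= _).
      by apply: ler_wpM2l; lra.
    by rewrite le_eqVlt; apply/orP; left; apply/eqP; field; rewrite gt_eqF; lra.
  by lra.
apply: le_trans H1 _.
have -> : log2 (n%:R * T)%R = log2 n%:R + 2 * (((cost P).+1 * (12 * j).+1)%N)%:R.
  rewrite log2M; try lra.
  rewrite /T (_ : 4 = 2 ^+ 2); last by ring.
  by rewrite -exprM log2X ?ltr0n // log2_2 mulr1 natrM.
rewrite natrM -[(cost P).+1%:R]natr1 -[(12 * j).+1%:R]natr1 natrM.
have : 1 <= (cost P)%:R :> R by rewrite ler1n.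
move: ((cost P)%:R : R) (j%:R : R) (log2 n%:R) l1 hj (ler0n R j) => c jr l l1 hj jr0 c1'.
(* As [c] and [l] are at least 1, the total is at most [2 l + 8 c (12 l + 37) + 10 <= 404 c l]. *)
have : (c + 1) * (12 * jr + 1) <= (2 * c) * (12 * (l + 3) + 1).
  by apply: ler_pM; lra.
have : 0 <= (c - 1) * (l - 1) by rewrite mulr_ge0; lra.
by move=> h1 h2; nra.
Qed.

End LowerBounds.

(** Common to both regimes of [kappa]: [D] is a constant in one and the whole denominator in the
    other. For [kappa s k <= 1] the left side is at most 0. *)
Lemma kappa_BQC (n : nat) (f : Bits n -> Bits n -> R) (s : seq R) (k : nat) (D : R) :
  (forall x y, f x y = 1 \/ f x y = -1) -> singular_values (Mf f) s -> (1 <= k)%N ->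
  0 < kappa s k -> 0 < D -> log2 (Num.sqrt k%:R) - log2 (kappa s k) + 1 <= D ->
  log2 (kappa s k) / (197 * D) <= BQC f.
Proof.
move=> hf hs k1 ka0 D0 hD; apply: BQC_ge => // P hP.
rewrite ler_pdivrMr; last by lra.
have c0 := ler0n R (cost P).
have [ka1|ka1] := leP (kappa s k) 1.
  apply: le_trans (_ : 0 <= _); first by rewrite -log2_1; apply: le_log2.
  by rewrite !mulr_ge0 // ltW.
apply: le_trans (kappa_cost hf hs hP k1 ka1) _.
by have := ler_wpM2l c0 hD; lra.
Qed.

Theorem theorem6p10 :
  (* BQC(f) = Omega(H(sigma^2(f)) / log n) *)
  (exists c : R, 0 < c /\ exists N0 : nat, forall n : nat, (N0 <= n)%N ->
     forall (f : Bits n -> Bits n -> R) (s : seq R),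
       (forall x y, f x y = 1 \/ f x y = -1) ->
       singular_values (Mf f) s ->
       c * (entropy_sq s / log2 n%:R) <= BQC f)
  /\
  (* kappa_k >= Omega(sqrt k)  ==>  BQC(f) = Omega(log kappa_k) *)
  (forall c1 : R, 0 < c1 ->
   exists c : R, 0 < c /\ exists N0 : nat, forall n : nat, (N0 <= n)%N ->
     forall (f : Bits n -> Bits n -> R) (s : seq R) (k : nat),
       (forall x y, f x y = 1 \/ f x y = -1) ->
       singular_values (Mf f) s -> (1 <= k)%N ->
       c1 * Num.sqrt k%:R <= kappa s k ->
       c * log2 (kappa s k) <= BQC f)
  /\
  (* kappa_k <= O(sqrt k)  ==>
     BQC(f) = Omega(log kappa_k / (log sqrt k - log kappa_k + 1)) *)
  (forall C1 : R, 0 < C1 ->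
   exists c : R, 0 < c /\ exists N0 : nat, forall n : nat, (N0 <= n)%N ->
     forall (f : Bits n -> Bits n -> R) (s : seq R) (k : nat),
       (forall x y, f x y = 1 \/ f x y = -1) ->
       singular_values (Mf f) s -> (1 <= k)%N ->
       kappa s k <= C1 * Num.sqrt k%:R ->
       c * (log2 (kappa s k)
            / (log2 (Num.sqrt k%:R) - log2 (kappa s k) + 1)) <= BQC f).
Proof.
split; [|split].
- exists (1 / 404)%R; split; first lra.
  (* From [n = 2] on, [log2 n >= 1], so the denominator is positive. *)
  exists 2%N => n n2 f s hf hs; apply: BQC_ge => // P hP.
  have l0 : 0 < log2 n%:R.
    apply: lt_le_trans (ltr01) _; rewrite -[leLHS]log2_2; apply: le_log2.
      by rewrite ltr0n.
    by rewrite ler_nat.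
  rewrite mulrA ler_pdivrMr //.
  by have := entropy_cost hf hs hP n2; lra.
(* The lower bound on [kappa] makes [log2 (sqrt k) - log2 kappa] at most [- log2 c1]. *)
- move=> c1 c1_gt0; pose D := `|log2 c1| + 1.
  have D0 : 0 < D by rewrite /D; have := normr_ge0 (log2 c1); lra.
  exists (197 * D)^-1; split; first by rewrite invr_gt0; lra.
  exists 0%N => n _ f s k hf hs k1 hk.
  have q0 : 0 < Num.sqrt k%:R :> R by rewrite sqrtr_gt0 ltr0n.
  have cq0 : 0 < c1 * Num.sqrt k%:R by rewrite mulr_gt0.
  rewrite mulrC; apply: kappa_BQC => //; first exact: lt_le_trans hk.
  have := le_log2 cq0 hk; rewrite log2M //.
  by have := ler_norm (- log2 c1); rewrite normrN /D; lra.
- move=> C1 _; exists (197^-1)%R; split; first by rewrite invr_gt0; lra.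
  exists 0%N => n _ f s k hf hs k1 _.
  (* For [kappa s k <= 0] the logarithm is 0 by convention and the claim is [0 <= BQC f]; otherwise
     [kappa_le_sqrt] makes the denominator at least 1. *)
  have [ka0|ka0] := leP (kappa s k) 0.
    rewrite (log2_npos ka0) mul0r mulr0.
    by apply: BQC_ge => // P _; apply: ler0n.
  set D := _ + 1.
  have D0 : 0 < D.
    by have := le_log2 ka0 (kappa_le_sqrt hf hs k1); rewrite /D; lra.
  have -> : 197^-1 * (log2 (kappa s k) / D) = log2 (kappa s k) / (197 * D).
    by rewrite invfM; ring.
  exact: kappa_BQC.
Qed.
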